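(* Let $G=\operatorname{SL}_2(\mathbb C)$ and $w(x,y)=[[x,y],x[x,y]x^{-1}]\in F_2$. Then each of the varieties $\mathcal T_w$ and $\mathcal W_w$ has exactly three irreducible components $\mathcal T_w^0,\mathcal T_w^1,\mathcal T_w^2$ and $\mathcal W_w^0,\mathcal W_w^1,\mathcal W_w^2$, respectively: $$\mathcal T_w^0=\mathcal T_{[x,y]},\qquad \mathcal T_w^1=\overline{\{g(T\times\dot wB)g^{-1}\mid g\in G\}},\qquad \mathcal T_w^2=C_{\dot w}\times G,$$ $$\mathcal W_w^0=\mathcal T_w^0,\qquad \mathcal W_w^1=\overline{\{g(T\times\dot wT)g^{-1}\mid g\in G\}}\subset\mathcal T_w^1,\quad \dim\mathcal W_w^1=4,\qquad \mathcal W_w^2=\mathcal T_w^2.$$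
   Context: $[a,b]=aba^{-1}b^{-1}$, and $F_2$ is the free group on $x,y$. For a word $v\in F_2$, $\mathcal W_v=\{(x,y)\in G\times G\mid v(x,y)=1\}$ and $\mathcal T_v=\{(x,y)\in G\times G\mid \operatorname{tr}v(x,y)=2\}$. $T$ and $B$ are the groups of diagonal and upper triangular matrices in $G$, respectively. $\dot w$ denotes an element of $N_G(T)\setminus T$, i.e. a matrix $\begin{pmatrix}0&\alpha\\-\alpha^{-1}&0\end{pmatrix}$ with $\alpha\in\mathbb C^*$; all such elements lie in a single conjugacy class of $G$, denoted $C_{\dot w}$ (and $\dot wT$, $\dot wB$ do not depend on the choice). $g(X\times Y)g^{-1}=gXg^{-1}\times gYg^{-1}$ denotes simultaneous conjugation, $\{g(X\times Y)g^{-1}\mid g\in G\}$ means the union of these sets over $g\in G$, and a bar denotes Zariski closure in $G\times G$. *)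

(* Defs.v *)
From HB Require Import structures.
From mathcomp Require Import all_boot all_order all_algebra.
From mathcomp Require Import boolp classical_sets reals topology_structure.
From mathcomp Require Import complex mpoly.

Set Implicit Arguments.
Unset Strict Implicit.
Unset Printing Implicit Defensive.

Import GRing.Theory.
Local Open Scope classical_set_scope.
Local Open Scope ring_scope.

Variant gen := gen_x | gen_y.

(* A word in x, x^-1, y, y^-1, standing for its class in the free group; the   *)
(* flag is true for an inverse letter. Words need not be reduced: evaluation   *)
(* in a group is invariant under free reduction, see eval_word_cancel.         *)
Definition word := seq (gen * bool).

Definition word_x : word := [:: (gen_x, false)].
Definition word_y : word := [:: (gen_y, false)].
Definition word_inv (v : word) : word := rev [seq (l.1, ~~ l.2) | l <- v].

(* The convention is [a, b] = a b a^-1 b^-1, unlike commg in the library. *)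
Definition word_comm (a b : word) : word :=
  a ++ b ++ word_inv a ++ word_inv b.

Section Eval.
Variable G : groupType.
Local Open Scope group_scope.

Definition eval_gen (x y : G) (g : gen) : G :=
  match g with gen_x => x | gen_y => y end.

Definition eval_letter (x y : G) (l : gen * bool) : G :=
  if l.2 then (eval_gen x y l.1)^-1 else eval_gen x y l.1.

Definition eval_word (v : word) (x y : G) : G :=
  \prod_(l <- v) eval_letter x y l.

Lemma eval_word_cat (v1 v2 : word) (x y : G) :
  eval_word (v1 ++ v2) x y = eval_word v1 x y * eval_word v2 x y.
Proof. by rewrite /eval_word big_cat. Qed.

Lemma eval_word_inv (v : word) (x y : G) :
  eval_word (word_inv v) x y = (eval_word v x y)^-1.
Proof.
rewrite /word_inv; elim: v => [|[g e] v IHv].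
  by rewrite /eval_word big_nil invg1.
rewrite map_cons rev_cons -cats1 eval_word_cat IHv.
rewrite /eval_word big_seq1 big_cons invgM; congr (_ * _).
by rewrite /eval_letter; case: e; rewrite /= ?invgK.
Qed.

Lemma eval_word_comm (a b : word) (x y : G) :
  eval_word (word_comm a b) x y =
  eval_word a x y * eval_word b x y *
    (eval_word a x y)^-1 * (eval_word b x y)^-1.
Proof. by rewrite !eval_word_cat !eval_word_inv !mulgA. Qed.

Lemma eval_word_cancel (a b : word) (g : gen) (e : bool) (x y : G) :
  eval_word (a ++ (g, e) :: (g, ~~ e) :: b) x y = eval_word (a ++ b) x y.
Proof.
rewrite !eval_word_cat; congr (_ * _); rewrite /eval_word !big_cons mulgA.
by rewrite /eval_letter; case: e; rewrite /= ?mulVg ?mulgV mul1g.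
Qed.

End Eval.

Section SL2.
Variable F : fieldType.

Record SL2 := MkSL2 { SL2_mx :> 'M[F]_2; SL2_det : \det SL2_mx == 1 }.

HB.instance Definition _ := [isSub for SL2_mx].
HB.instance Definition _ := [Choice of SL2 by <:].

Fact SL2_mul_subproof (A B : SL2) : \det (A *m B) == 1.
Proof. by rewrite det_mulmx (eqP (SL2_det A)) (eqP (SL2_det B)) mulr1. Qed.

Fact SL2_one_subproof : \det (1%:M : 'M[F]_2) == 1.
Proof. by rewrite det1. Qed.

Fact SL2_inv_subproof (A : SL2) : \det (invmx A) == 1.
Proof. by rewrite det_inv (eqP (SL2_det A)) invr1. Qed.

Definition SL2_mul (A B : SL2) : SL2 := MkSL2 (SL2_mul_subproof A B).
Definition SL2_one : SL2 := MkSL2 SL2_one_subproof.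
Definition SL2_inv (A : SL2) : SL2 := MkSL2 (SL2_inv_subproof A).

Fact SL2_mulA : associative SL2_mul.
Proof. by move=> A B C; apply/val_inj; rewrite /= mulmxA. Qed.

Fact SL2_mul1 : left_id SL2_one SL2_mul.
Proof. by move=> A; apply/val_inj; rewrite /= mul1mx. Qed.

Fact SL2_1mul : right_id SL2_one SL2_mul.
Proof. by move=> A; apply/val_inj; rewrite /= mulmx1. Qed.

Fact SL2_unitmx (A : SL2) : (A : 'M[F]_2) \in unitmx.
Proof. by rewrite unitmxE (eqP (SL2_det A)) unitr1. Qed.

Fact SL2_mulV : left_inverse SL2_one SL2_inv SL2_mul.
Proof. by move=> A; apply/val_inj; rewrite /= mulVmx // SL2_unitmx. Qed.

Fact SL2_Vmul : right_inverse SL2_one SL2_inv SL2_mul.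
Proof. by move=> A; apply/val_inj; rewrite /= mulmxV // SL2_unitmx. Qed.

HB.instance Definition _ :=
  isGroup.Build SL2 SL2_mulA SL2_mul1 SL2_1mul SL2_mulV SL2_Vmul.

Definition torus : set SL2 := [set A : SL2 | is_diag_mx A].

(* Upper triangular; the library's is_trig_mx means lower triangular. *)
Definition borel : set SL2 := [set A : SL2 | is_trig_mx (A : 'M[F]_2)^T].

End SL2.

Section GroupSets.
Variable G : groupType.
Local Open Scope group_scope.

Definition conj_set (g : G) (X : set G) : set G :=
  [set g * x * g^-1 | x in X].

Definition normalizer (X : set G) : set G := [set g | conj_set g X = X].

Definition conj_class (h : G) : set G := [set g * h * g^-1 | g in [set: G]].

Definition left_translate (h : G) (X : set G) : set G := [set h * x | x in X].

End GroupSets.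

Section Zariski.
Variable F : fieldType.

Definition SL2xSL2 : Type := (SL2 F * SL2 F)%type.
HB.instance Definition _ := Choice.on SL2xSL2.

(* The eight matrix entries, as coordinates on the ambient affine space. *)
Definition coords (p : SL2xSL2) (i : 'I_(2 * 2 + 2 * 2)) : F :=
  row_mx (mxvec p.1) (mxvec p.2) ord0 i.

Definition zero_locus (S : set {mpoly F[2 * 2 + 2 * 2]}) : set SL2xSL2 :=
  [set p | forall P, S P -> P.@[coords p] = 0].

Definition zariski_open : set (set SL2xSL2) :=
  [set U | exists S, ~` U = zero_locus S].

Fact zariski_openT : zariski_open setT.
Proof.
exists [set 1]; rewrite setCT; apply/seteqP; split=> // p /(_ 1 erefl).
by rewrite meval1 => /eqP; rewrite oner_eq0.
Qed.

Fact zariski_openI : setI_closed zariski_open.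
Proof.
move=> U V [S1 US1] [S2 VS2].
exists [set (P.1 * P.2)%R | P in S1 `*` S2].
rewrite setCI US1 VS2; apply/seteqP; split=> [p + _ [[P Q] [/= SP SQ] <-]|p H].
  by rewrite mevalM => -[H|H]; [rewrite (H _ SP) mul0r|rewrite (H _ SQ) mulr0].
apply: contrapT => /not_orP [/existsNP [P /not_implyP [SP P0]]].
move=> /existsNP [Q /not_implyP [SQ Q0]].
have /eqP := H (P * Q)%R (ex_intro2 _ _ (P, Q) (conj SP SQ) erefl).
by rewrite mevalM mulf_eq0 => /orP[] /eqP.
Qed.

Fact zariski_open_bigU (J : Type) (f : J -> set SL2xSL2) :
  (forall i, zariski_open (f i)) -> zariski_open (\bigcup_i f i).
Proof.
move=> /choice [S fS]; exists (\bigcup_i S i).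
rewrite setC_bigcup; apply/seteqP; split=> [p H P [i _ SP]|p H i _].
  by have := H i I; rewrite fS; apply.
by rewrite fS => P SP; apply: H; exists i.
Qed.

HB.instance Definition _ := isOpenTopological.Build SL2xSL2
  zariski_openT zariski_openI zariski_open_bigU.

Lemma zariski_closedP (A : set SL2xSL2) :
  closed A <-> exists S, A = zero_locus S.
Proof.
by rewrite -openC; split=> -[S AS]; exists S; move: AS; rewrite setCK.
Qed.

Definition conj_saturation (X Y : set (SL2 F)) : set SL2xSL2 :=
  \bigcup_(g in [set: SL2 F]) (conj_set g X `*` conj_set g Y).

Definition word_variety (v : word) : set SL2xSL2 :=
  [set p : SL2xSL2 | eval_word v p.1 p.2 = 1%g].

Definition trace_variety (v : word) : set SL2xSL2 :=
  [set p : SL2xSL2 | \tr (SL2_mx (eval_word v p.1 p.2)) = 2%:R].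

End Zariski.

Section Irreducible.
Variable T : topologicalType.

Definition irreducible_set (A : set T) : Prop :=
  A !=set0 /\
  forall C1 C2 : set T, closed C1 -> closed C2 ->
    A `<=` C1 `|` C2 -> A `<=` C1 \/ A `<=` C2.

Definition irreducible_components (A : set T) : set (set T) :=
  [set Z | [/\ irreducible_set Z, Z `<=` A &
    forall Z', irreducible_set Z' -> Z' `<=` A -> Z `<=` Z' -> Z' = Z]].

Definition has_irreducible_chain (A : set T) (n : nat) : Prop :=
  exists Z : nat -> set T,
    (forall i, (i <= n)%N ->
      irreducible_set (Z i) /\ exists2 C, closed C & Z i = A `&` C) /\
    (forall i, (i < n)%N -> Z i `<` Z i.+1).

Definition has_krull_dim (A : set T) (n : nat) : Prop :=
  has_irreducible_chain A n /\
  forall m, has_irreducible_chain A m -> (m <= n)%N.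

End Irreducible.

(* Main.v *)
Require Import Defs.
From HB Require Import structures.
From mathcomp Require Import all_boot all_order all_algebra.
From mathcomp Require Import boolp classical_sets reals topology_structure.
From mathcomp Require Import complex mpoly.
From mathcomp Require Import ring.

Set Implicit Arguments.
Unset Strict Implicit.
Unset Printing Implicit Defensive.

Import Order.TTheory GRing.Theory Num.Theory.
Local Open Scope classical_set_scope.
Local Open Scope ring_scope.

(** Put s = tr x, t = tr y, u = tr xy, c = [x,y] and k = tr c. Fricke's formula
    k = s^2 + t^2 + u^2 - stu - 2, applied to [x,y], to [c,x] and to
    w = [c, x c x^-1], gives the factorization

      tr w - 2 = s^2 (k - 2)^2 (stu - t^2 - u^2)

    (SL2_tr_word). The three factors are the three components of the trace
    variety. If x = diag(l, 1/l), the cubic factor equals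
    (l - 1/l)^2 y_11 y_22, so off the locus k = 2 it vanishes exactly when
    (x, y) is conjugate to a diagonal matrix paired with a matrix whose (1,1)
    entry is zero, i.e. an element of wB; for x = +-1 or +- a unipotent matrix
    the cubic equals 2 - k, so such an x contributes nothing new
    (cubic_form_eq0_conj). The equation w = 1 holds on k = 2, where x and y are
    simultaneously triangular, and on s = 0, where x c x^-1 = c^-1; on the cubic
    locus with s <> 0 it forces the (2,2) entry of y to vanish as well, which
    replaces wB by wT (word_map_diag).

    Each piece, or a dense part of it, is the union of the conjugates of a
    product of two sets built from SL2, T, B and points. Any two points of such
    a set are joined by a rational curve inside it, because SL2 is generated by
    elementary matrices, and this makes it irreducible
    (conj_orbit_irreducible). Three points with x or y equal to diag(2, 1/2)
    show that no piece lies in the union of the other two.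

    For the dimension of the closure of the conjugates of T x wT, a strictly
    increasing chain of n + 1 irreducible relatively closed subsets yields n
    algebraically independent polynomials on the largest one
    (irreducible_chain_independent). But the big cell of SL2 parametrizes the
    conjugates by four parameters, up to the denominators of the parameters,
    and five such functions are dependent, since there are more monomials of
    bounded degree in five variables than in four (parametrized_dependent).
    Conversely, inside the closed orbit s = t = u = 0 of the quaternion pair
    (i, j), the orbits of 1, of the unipotent group, of the Borel subgroup and
    of SL2 are closed of dimension 0, 1, 2 and 3 (traceless_chain). *)

(** * Irreducible sets and their closures *)

Section Topology.
Variable T : topologicalType.
Implicit Types A C Z : set T.

Lemma closure_sub A C : closed C -> A `<=` C -> closure A `<=` C.
Proof. by move=> cC AC; rewrite closureE; apply: smallest_sub. Qed.

Lemma irreducible_closure A : irreducible_set A -> irreducible_set (closure A).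
Proof.
move=> [[x Ax] irrA]; split; first by exists x; apply: subset_closure.
move=> C1 C2 cC1 cC2 AC.
have [AC1|AC2] := irrA _ _ cC1 cC2 (subset_trans (@subset_closure _ A) AC).
  by left; apply: closure_sub.
by right; apply: closure_sub.
Qed.

(** An irreducible set inside a finite union of closed sets lies in one of
    them, so the maximal ones are the pieces of an irredundant union. *)
Lemma irreducible_components3 Z0 Z1 Z2 :
  irreducible_set Z0 -> irreducible_set Z1 -> irreducible_set Z2 ->
  closed Z0 -> closed Z1 -> closed Z2 ->
  ~ (Z0 `<=` Z1 `|` Z2) -> ~ (Z1 `<=` Z0 `|` Z2) -> ~ (Z2 `<=` Z0 `|` Z1) ->
  irreducible_components (Z0 `|` Z1 `|` Z2) = [set Z0; Z1; Z2] /\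
  [/\ Z0 <> Z1, Z0 <> Z2 & Z1 <> Z2].
Proof.
move=> irr0 irr1 irr2 cl0 cl1 cl2 n0 n1 n2; split; last first.
  split=> E.
  - by apply: n0; rewrite E => x; left.
  - by apply: n0; rewrite E => x; right.
  - by apply: n1; rewrite E => x; right.
have cover Z' : irreducible_set Z' -> Z' `<=` Z0 `|` Z1 `|` Z2 ->
    [\/ Z' `<=` Z0, Z' `<=` Z1 | Z' `<=` Z2].
  move=> [_ irrZ'] Z'sub.
  case: (irrZ' _ _ (closedU cl0 cl1) cl2 Z'sub) => [sub|]; last exact: Or33.
  by case: (irrZ' _ _ cl0 cl1 sub); [apply: Or31|apply: Or32].
apply/seteqP; split=> [Z [irrZ Zsub Zmax]|Z].
  case: (cover Z irrZ Zsub) => Zi.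
  - by left; left; rewrite (Zmax Z0) // => x; left; left.
  - by left; right; rewrite (Zmax Z1) // => x; left; right.
  - by right; rewrite (Zmax Z2) // => x; right.
case=> [[|]|] /= ->; split=> //.
- by move=> x; left; left.
- move=> Z' irrZ' Z'sub ZZ'; apply/seteqP; split=> //.
  case: (cover Z' irrZ' Z'sub) => // Z'i; case: n0 => x /ZZ' /Z'i.
    by left.
  by right.
- by move=> x; left; right.
- move=> Z' irrZ' Z'sub ZZ'; apply/seteqP; split=> //.
  case: (cover Z' irrZ' Z'sub) => // Z'i; case: n1 => x /ZZ' /Z'i.
    by left.
  by right.
- move=> Z' irrZ' Z'sub ZZ'; apply/seteqP; split=> //.
  case: (cover Z' irrZ' Z'sub) => // Z'i; case: n2 => x /ZZ' /Z'i.
    by left.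
  by right.
Qed.

End Topology.

(** * Rational functions without poles on an open subset of the line *)

Section Regular.
Variable F : numFieldType.
Implicit Types (D p q : {poly F}) (f g : F -> F).

(** Characteristic 0 makes the field infinite, whereas a nonzero polynomial has
    finitely many roots. *)
Lemma poly_eq0_eval p : (forall t, p.[t] = 0) -> p = 0.
Proof.
move=> p0; apply: contrapT => /eqP pN0.
have := @max_poly_roots F p [seq i%:R | i <- iota 0 (size p)] pN0.
rewrite size_map size_iota ltnn => H; suff: false by []; apply: H.
  by apply/allP => x _; rewrite rootE p0.
by rewrite map_inj_uniq ?iota_uniq // => i j /eqP; rewrite eqr_nat => /eqP.
Qed.

(** f is a quotient of polynomials, without poles, on the locus where D does not
    vanish; its values elsewhere are arbitrary. *)
Definition regular D f := exists p q, forall t, D.[t] != 0 ->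
  q.[t] != 0 /\ f t = p.[t] / q.[t].

Lemma regular_poly D p : regular D (fun t => p.[t]).
Proof. by exists p, 1 => t _; rewrite hornerE oner_eq0 divr1. Qed.

Lemma regular_cst D a : regular D (fun=> a).
Proof. by exists a%:P, 1 => t _; rewrite !hornerE oner_eq0 divr1. Qed.

Lemma regularD D f g :
  regular D f -> regular D g -> regular D (fun t => f t + g t).
Proof.
move=> [p1 [q1 H1]] [p2 [q2 H2]]; exists (p1 * q2 + p2 * q1), (q1 * q2) => t Dt.
have [n1 ->] := H1 t Dt; have [n2 ->] := H2 t Dt.
by rewrite !hornerE mulf_neq0 // addf_div.
Qed.

Lemma regularM D f g :
  regular D f -> regular D g -> regular D (fun t => f t * g t).
Proof.
move=> [p1 [q1 H1]] [p2 [q2 H2]]; exists (p1 * p2), (q1 * q2) => t Dt.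
have [n1 ->] := H1 t Dt; have [n2 ->] := H2 t Dt.
by rewrite !hornerM mulf_div mulf_neq0.
Qed.

Lemma regularN D f : regular D f -> regular D (fun t => - f t).
Proof.
move=> [p [q H]]; exists (- p), q => t Dt.
by have [n ->] := H t Dt; rewrite hornerN mulNr.
Qed.

Lemma regularV D f : (forall t, D.[t] != 0 -> f t != 0) ->
  regular D f -> regular D (fun t => (f t)^-1).
Proof.
move=> fN0 [p [q H]]; exists q, p => t Dt.
have := fN0 t Dt; have [n ->] := H t Dt.
by rewrite mulf_eq0 negb_or => /andP[]; rewrite invf_div.
Qed.

Lemma regular_sub D D' f :
  (forall t, D'.[t] != 0 -> D.[t] != 0) -> regular D f -> regular D' f.
Proof. by move=> DD' [p [q H]]; exists p, q => t /DD'; apply: H. Qed.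

End Regular.

(** * Matrix entries and trace identities in SL2 *)

Local Notation e11 x := (SL2_mx x 0 0).
Local Notation e12 x := (SL2_mx x 0 1).
Local Notation e21 x := (SL2_mx x 1 0).
Local Notation e22 x := (SL2_mx x 1 1).
Local Notation "'tr' x" := (\tr (SL2_mx x)) (at level 10, x at level 9).

Section Entries.
Variable F : fieldType.
Implicit Types x y g : SL2 F.

Lemma ord2P (P : 'I_2 -> Prop) : P 0 -> P 1 -> forall i, P i.
Proof.
move=> P0 P1 [[|[|//]] i2].
  by rewrite (_ : Ordinal i2 = 0) //; apply/val_inj.
by rewrite (_ : Ordinal i2 = 1) //; apply/val_inj.
Qed.

Lemma big_ord2 (f : 'I_2 -> F) : \sum_i f i = f 0 + f 1.
Proof.
by rewrite !big_ord_recl big_ord0 addr0; congr (_ + f _); apply/val_inj.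
Qed.

Lemma det_mx22 (A : 'M[F]_2) : \det A = A 0 0 * A 1 1 - A 0 1 * A 1 0.
Proof.
rewrite (expand_det_row _ 0) big_ord2 /cofactor !det_mx11 !mxE /= expr0 expr1.
rewrite mul1r mulN1r mulrN; congr (_ * A _ _ - _ * A _ _); exact/val_inj.
Qed.

Lemma SL2_detE x : e11 x * e22 x - e12 x * e21 x = 1.
Proof. by rewrite -(eqP (SL2_det x)) det_mx22. Qed.

Lemma SL2_eq x y :
  e11 x = e11 y -> e12 x = e12 y -> e21 x = e21 y -> e22 x = e22 y -> x = y.
Proof.
by move=> ? ? ? ?; apply/val_inj/matrixP; apply: ord2P; apply: ord2P.
Qed.

Lemma SL2_trE x : \tr (SL2_mx x) = e11 x + e22 x.
Proof. exact: big_ord2. Qed.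

Lemma SL2_mulE x y :
  (e11 (x * y)%g = e11 x * e11 y + e12 x * e21 y) *
  (e12 (x * y)%g = e11 x * e12 y + e12 x * e22 y) *
  (e21 (x * y)%g = e21 x * e11 y + e22 x * e21 y) *
  (e22 (x * y)%g = e21 x * e12 y + e22 x * e22 y).
Proof. by rewrite !mxE !big_ord2. Qed.

Lemma SL2_oneE :
  (e11 (1%g : SL2 F) = 1) * (e12 (1%g : SL2 F) = 0) *
  (e21 (1%g : SL2 F) = 0) * (e22 (1%g : SL2 F) = 1).
Proof. by rewrite !mxE. Qed.

Definition mat2 (a b c d : F) : 'M[F]_2 :=
  \matrix_(i, j) if i == 0 then (if j == 0 then a else b)
                 else (if j == 0 then c else d).

(** Total, so that families of matrices are plain functions of their parameters;
    the value is the identity when a * d - b * c is not 1. *)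
Definition mkSL2 (a b c d : F) : SL2 F := insubd (1%g : SL2 F) (mat2 a b c d).

Lemma mkSL2E a b c d : a * d - b * c = 1 ->
  (e11 (mkSL2 a b c d) = a) * (e12 (mkSL2 a b c d) = b) *
  (e21 (mkSL2 a b c d) = c) * (e22 (mkSL2 a b c d) = d).
Proof.
move=> H; have -> : SL2_mx (mkSL2 a b c d) = mat2 a b c d.
  by rewrite /mkSL2 -[SL2_mx _]/(val _) val_insubd det_mx22 !mxE H eqxx.
by rewrite !mxE.
Qed.

Lemma SL2_invE x :
  (e11 (x^-1)%g = e22 x) * (e12 (x^-1)%g = - e12 x) *
  (e21 (x^-1)%g = - e21 x) * (e22 (x^-1)%g = e11 x).
Proof.
have H : e22 x * e11 x - (- e12 x) * (- e21 x) = 1.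
  by rewrite -(SL2_detE x); ring.
suff -> : (x^-1)%g = mkSL2 (e22 x) (- e12 x) (- e21 x) (e11 x).
  by rewrite !(mkSL2E H).
apply: (mulgI x); rewrite mulgV; apply: SL2_eq;
  by rewrite !SL2_mulE !(mkSL2E H) !SL2_oneE -?(SL2_detE x); ring.
Qed.

Definition SL2E := (SL2_mulE, SL2_invE, SL2_oneE).

Lemma SL2_trV x : tr (x^-1)%g = tr x.
Proof. by rewrite !SL2_trE !SL2E addrC. Qed.

Lemma SL2_trJ g x : \tr (SL2_mx (g * x * g^-1)%g) = \tr (SL2_mx x).
Proof. by rewrite /= mxtrace_mulC /= mulmxA mulVmx ?mul1mx // SL2_unitmx. Qed.

(** Fricke's formula. Made homogeneous by inserting the two determinants, it is a
    polynomial identity in the eight entries. *)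
Lemma SL2_tr_comm x y : \tr (SL2_mx (x * y * x^-1 * y^-1)%g) =
  \tr (SL2_mx x) ^+ 2 + \tr (SL2_mx y) ^+ 2 + \tr (SL2_mx (x * y)%g) ^+ 2
  - \tr (SL2_mx x) * \tr (SL2_mx y) * \tr (SL2_mx (x * y)%g) - 2.
Proof.
have -> : 2%:R = 2 * ((e11 x * e22 x - e12 x * e21 x) *
                  (e11 y * e22 y - e12 y * e21 y)) :> F.
  by rewrite !SL2_detE !mulr1.
have -> : \tr (SL2_mx x) ^+ 2 = \tr (SL2_mx x) ^+ 2 * (e11 y * e22 y - e12 y * e21 y).
  by rewrite SL2_detE mulr1.
have -> : \tr (SL2_mx y) ^+ 2 = \tr (SL2_mx y) ^+ 2 * (e11 x * e22 x - e12 x * e21 x).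
  by rewrite SL2_detE mulr1.
by rewrite !SL2_trE !SL2E; ring.
Qed.

(** This is Cayley-Hamilton, y + y^-1 = tr y, multiplied by x. *)
Lemma SL2_tr_mulV x y : \tr (SL2_mx (x * y^-1)%g) =
  \tr (SL2_mx x) * \tr (SL2_mx y) - \tr (SL2_mx (x * y)%g).
Proof. by rewrite !SL2_trE !SL2E; ring. Qed.

(** Cyclic invariance brings the two letters x together, and Cayley-Hamilton
    replaces x^2 by (tr x) x - 1. *)
Lemma SL2_tr_comm_mul x y : \tr (SL2_mx (x * y * x^-1 * y^-1 * x)%g) =
  \tr (SL2_mx x) * (\tr (SL2_mx (x * y * x^-1 * y^-1)%g) - 1).
Proof.
rewrite -[X in _ - X]mulr1 -[X in _ - X * _](SL2_detE x) -[X in _ - _ * X](SL2_detE y).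
by rewrite !SL2_trE !SL2E; ring.
Qed.

(** Let k = tr c. As z is conjugate to c, Fricke's formula for [c,z] factors as
    tr [c,z] - 2 = (m - 2) (m + 2 - k^2) with m = tr cz. Moreover c z^-1 = [c,x],
    whence m = k^2 - tr [c,x], and Fricke's formula for [c,x] turns the two
    factors into s^2 (k - 2) and (k - 2) (s^2 - 2 - k); by Fricke's formula for
    [x,y], the last factor is s t u - t^2 - u^2. *)
Lemma SL2_tr_word x y (c := (x * y * x^-1 * y^-1)%g) (z := (x * c * x^-1)%g)
    (s := \tr (SL2_mx x)) (t := \tr (SL2_mx y)) (u := \tr (SL2_mx (x * y)%g)) :
  \tr (SL2_mx (c * z * c^-1 * z^-1)%g) - 2 =
  s ^+ 2 * (\tr (SL2_mx c) - 2) ^+ 2 * (s * t * u - t ^+ 2 - u ^+ 2).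
Proof.
have zE : \tr (SL2_mx z) = \tr (SL2_mx c) by rewrite /z SL2_trJ.
have czE : \tr (SL2_mx (c * z)%g) = \tr (SL2_mx c) ^+ 2 - \tr (SL2_mx (c * x * c^-1 * x^-1)%g).
  rewrite expr2 -{2}zE -[LHS](subKr (\tr (SL2_mx c) * \tr (SL2_mx z))).
  by rewrite -SL2_tr_mulV /z !invgM invgK !mulgA.
rewrite SL2_tr_comm czE zE SL2_tr_comm SL2_tr_comm_mul -/c -/s.
rewrite (_ : \tr (SL2_mx c) = s ^+ 2 + t ^+ 2 + u ^+ 2 - s * t * u - 2).
  by ring.
by rewrite /c SL2_tr_comm.
Qed.

End Entries.

(** * Elementary matrices, the torus and the Borel subgroup *)

Section Subgroups.
Variable F : fieldType.
Implicit Types (x y g : SL2 F) (a b l : F).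

Definition upper a : SL2 F := mkSL2 1 a 0 1.
Definition lower a : SL2 F := mkSL2 1 0 a 1.
Definition diag l : SL2 F := mkSL2 l 0 0 l^-1.
Definition antidiag b : SL2 F := mkSL2 0 b (- b^-1) 0.

Lemma upperE a : (e11 (upper a) = 1) * (e12 (upper a) = a) *
  (e21 (upper a) = 0) * (e22 (upper a) = 1).
Proof. by rewrite !mkSL2E ?mulr1 ?mulr0 ?subr0. Qed.

Lemma lowerE a : (e11 (lower a) = 1) * (e12 (lower a) = 0) *
  (e21 (lower a) = a) * (e22 (lower a) = 1).
Proof. by rewrite !mkSL2E ?mulr1 ?mul0r ?subr0. Qed.

Lemma diagE l : l != 0 -> (e11 (diag l) = l) * (e12 (diag l) = 0) *
  (e21 (diag l) = 0) * (e22 (diag l) = l^-1).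
Proof. by move=> l0; rewrite !mkSL2E ?mulfV ?mulr0 ?subr0. Qed.

Lemma antidiagE b : b != 0 -> (e11 (antidiag b) = 0) * (e12 (antidiag b) = b) *
  (e21 (antidiag b) = - b^-1) * (e22 (antidiag b) = 0).
Proof. by move=> b0; rewrite !mkSL2E ?mulrN ?mulfV ?mulr0 ?opprK ?add0r. Qed.

Lemma torusP x : torus x <-> e12 x = 0 /\ e21 x = 0.
Proof.
split=> [/is_diag_mxP H|[x12 x21]]; first by rewrite !H.
by apply/is_diag_mxP; apply: ord2P; apply: ord2P.
Qed.

Lemma borelP x : borel x <-> e21 x = 0.
Proof.
split=> [/is_trig_mxP/(_ 0 1 isT)|x21]; first by rewrite mxE.
by apply/is_trig_mxP; apply: ord2P; apply: ord2P; rewrite // mxE.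
Qed.

Lemma borel_e11_neq0 x : borel x -> e11 x != 0.
Proof.
move=> /borelP x21; have := SL2_detE x; rewrite x21 mulr0 subr0.
by apply: contra_eq_neq => ->; rewrite mul0r eq_sym oner_eq0.
Qed.

Lemma e22_inv x : e12 x = 0 \/ e21 x = 0 -> e22 x = (e11 x)^-1.
Proof.
move=> H; have D : e11 x * e22 x = 1.
  by rewrite -(SL2_detE x); case: H => ->; ring.
have x11 : e11 x != 0 by apply: contra_eq_neq D => ->; rewrite mul0r eq_sym oner_eq0.
by apply: (mulfI x11); rewrite D mulfV.
Qed.

Lemma borel_diag_upper : @borel F =
  [set (x * y)%g | x in [set diag l | l in [set l | l != 0]] & y in range upper].
Proof.
apply/seteqP; split=> [x Bx|_ [_ [l l0 <-] [_ [a _ <-] <-]]]; last first.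
  by apply/borelP; rewrite SL2E !upperE !diagE //; ring.
have x11 := borel_e11_neq0 Bx; move/borelP: Bx => x21.
exists (diag (e11 x)); first by exists (e11 x).
exists (upper (e12 x / e11 x)); first by exists (e12 x / e11 x).
by apply: SL2_eq; rewrite !SL2E !upperE !diagE // ?x21 ?(e22_inv (or_intror x21)); field.
Qed.

Lemma torus_diag : @torus F = [set diag l | l in [set l | l != 0]].
Proof.
apply/seteqP; split=> [x|_ [l l0 <-]]; last by apply/torusP; rewrite !diagE.
move=> /torusP [x12 x21]; have x11 := borel_e11_neq0 ((borelP x).2 x21).
exists (e11 x) => //.
by apply: SL2_eq; rewrite !diagE // ?x12 ?x21 ?(e22_inv (or_intror x21)).
Qed.

(** When the (2,1) entry is nonzero, a matrix is an upper, lower, upper product;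
    the last lower factor brings any matrix to that case. *)
Lemma SL2_elementary : [set: SL2 F] =
  [set (x * y)%g | x in [set (x * y)%g | x in [set (x * y)%g |
     x in range upper & y in range lower] & y in range upper]
     & y in range lower].
Proof.
apply/seteqP; split=> // x _.
have decomp y : e21 y != 0 -> y =
    (upper ((e11 y - 1) / e21 y) * lower (e21 y) * upper ((e22 y - 1) / e21 y))%g.
  move=> y21; have y12 : e12 y = (e11 y * e22 y - 1) / e21 y.
    by rewrite -(SL2_detE y); field.
  by apply: SL2_eq; rewrite !SL2E !upperE !lowerE ?y12; field.
have mem y : e21 y != 0 -> [set (x * y)%g | x in [set (x * y)%g |
     x in range upper & y in range lower] & y in range upper] y.
  move=> y21; exists (upper ((e11 y - 1) / e21 y) * lower (e21 y))%g.
    exists (upper ((e11 y - 1) / e21 y)); first by eexists.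
    by exists (lower (e21 y)) => //; exists (e21 y).
  exists (upper ((e22 y - 1) / e21 y)); first by eexists.
  by rewrite -decomp.
have [x21|x21] := eqVneq (e21 x) 0.
  exists (x * lower 1)%g.
    apply: mem; rewrite SL2E !lowerE x21 mul0r add0r mulr1.
    rewrite (e22_inv (or_intror x21)) invr_eq0.
    exact/borel_e11_neq0/borelP.
  exists (lower (-1)); first by exists (-1).
  by apply: SL2_eq; rewrite !SL2E !lowerE; ring.
exists x; first exact: mem.
exists (lower 0); first by exists 0.
by apply: SL2_eq; rewrite !SL2E !lowerE; ring.
Qed.

End Subgroups.

(** * Matrices with entries in a ring of functions *)

Section FunctionRings.
Variables (F : fieldType) (X : Type).

(** Rings of functions that only matter on dom. The three instances used below
    are the functions on an open subset of the line, the polynomial functions on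
    pairs of matrices and the localized polynomials on a parameter space. *)
Definition function_ring (dom : set X) (S : (X -> F) -> Prop) :=
  [/\ forall a, S (fun=> a),
      forall f f', S f -> S f' -> S (fun x => f x + f' x),
      forall f f', S f -> S f' -> S (fun x => f x * f' x),
      forall f, S f -> S (fun x => - f x) &
      forall f f', S f -> (forall x, dom x -> f' x = f x) -> S f'].

Definition SL2_valued (S : (X -> F) -> Prop) (h : X -> SL2 F) :=
  forall i j, S (fun x => SL2_mx (h x) i j).

Variables (dom : set X) (S : (X -> F) -> Prop).
Hypothesis ringS : function_ring dom S.

Lemma SL2_valued_entries h f11 f12 f21 f22 :
  S f11 -> S f12 -> S f21 -> S f22 ->
  (forall x, dom x -> [/\ e11 (h x) = f11 x, e12 (h x) = f12 x,
                          e21 (h x) = f21 x & e22 (h x) = f22 x]) ->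
  SL2_valued S h.
Proof.
case: ringS => _ _ _ _ Seq S11 S12 S21 S22 E; apply: ord2P; apply: ord2P.
- by apply: Seq S11 _ => x /E[].
- by apply: Seq S12 _ => x /E[].
- by apply: Seq S21 _ => x /E[].
- by apply: Seq S22 _ => x /E[].
Qed.

Lemma SL2_valued_cst g : SL2_valued S (fun=> g).
Proof. by case: ringS => Sc _ _ _ _ i j; apply: Sc. Qed.

Lemma SL2_valuedM h h' :
  SL2_valued S h -> SL2_valued S h' -> SL2_valued S (fun x => h x * h' x)%g.
Proof.
case: ringS => _ SD SM _ Seq Sh Sh' i j.
apply: Seq (SD _ _ (SM _ _ (Sh i 0) (Sh' 0 j)) (SM _ _ (Sh i 1) (Sh' 1 j))) _.
by move=> x _; rewrite mxE big_ord2.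
Qed.

Lemma SL2_valuedV h : SL2_valued S h -> SL2_valued S (fun x => (h x)^-1)%g.
Proof.
case: ringS => _ _ _ SN _ Sh.
apply: SL2_valued_entries (Sh 1 1) (SN _ (Sh 0 1)) (SN _ (Sh 1 0)) (Sh 0 0) _.
by move=> x _; rewrite !SL2E.
Qed.

Lemma SL2_valued_conj h h' : SL2_valued S h -> SL2_valued S h' ->
  SL2_valued S (fun x => h x * h' x * (h x)^-1)%g.
Proof. by move=> Sh Sh'; apply: SL2_valuedM (SL2_valuedM Sh Sh') (SL2_valuedV Sh). Qed.

Lemma SL2_valued_upper f : S f -> SL2_valued S (fun x => upper (f x)).
Proof.
move=> Sf; have [Sc _ _ _ _] := ringS.
by apply: SL2_valued_entries (Sc 1) Sf (Sc 0) (Sc 1) _ => x _; rewrite !upperE.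
Qed.

Lemma SL2_valued_lower f : S f -> SL2_valued S (fun x => lower (f x)).
Proof.
move=> Sf; have [Sc _ _ _ _] := ringS.
by apply: SL2_valued_entries (Sc 1) (Sc 0) Sf (Sc 1) _ => x _; rewrite !lowerE.
Qed.

Lemma SL2_valued_diag f : (forall x, dom x -> f x != 0) ->
  S f -> S (fun x => (f x)^-1) -> SL2_valued S (fun x => diag (f x)).
Proof.
move=> f0 Sf SV; have [Sc _ _ _ _] := ringS.
by apply: SL2_valued_entries Sf (Sc 0) (Sc 0) SV _ => x /f0 fx; rewrite !diagE.
Qed.

Lemma SL2_valued_antidiag f : (forall x, dom x -> f x != 0) ->
  S f -> S (fun x => (f x)^-1) -> SL2_valued S (fun x => antidiag (f x)).
Proof.
move=> f0 Sf SV; have [Sc _ _ SN _] := ringS.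
apply: SL2_valued_entries (Sc 0) Sf (SN _ SV) (Sc 0) _ => x /f0 fx.
by rewrite !antidiagE.
Qed.

Lemma SL2_valued_tr h : SL2_valued S h -> S (fun x => \tr (SL2_mx (h x))).
Proof.
have [_ SD _ _ Seq] := ringS => Sh.
by apply: Seq (SD _ _ (Sh 0 0) (Sh 1 1)) _ => x _; rewrite SL2_trE.
Qed.

Lemma function_ring_sum (I : Type) (r : seq I) (f : I -> X -> F) :
  (forall i, S (f i)) -> S (fun x => \sum_(i <- r) f i x).
Proof.
have [Sc SD _ _ Seq] := ringS => fS; elim: r => [|i r IHr].
  by apply: Seq (Sc 0) _ => x _; rewrite big_nil.
by apply: Seq (SD _ _ (fS i) IHr) _ => x _; rewrite big_cons.
Qed.

Lemma function_ring_prod (I : Type) (r : seq I) (f : I -> X -> F) :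
  (forall i, S (f i)) -> S (fun x => \prod_(i <- r) f i x).
Proof.
have [Sc _ SM _ Seq] := ringS => fS; elim: r => [|i r IHr].
  by apply: Seq (Sc 1) _ => x _; rewrite big_nil.
by apply: Seq (SM _ _ (fS i) IHr) _ => x _; rewrite big_cons.
Qed.

Lemma function_ring_exp f k : S f -> S (fun x => f x ^+ k).
Proof.
have [Sc _ SM _ Seq] := ringS => fS; elim: k => [|k IHk]; first exact: Sc.
by apply: Seq (SM _ _ fS IHk) _ => x _; rewrite exprS.
Qed.

Lemma function_ring_meval n (v : X -> 'I_n -> F) (P : {mpoly F[n]}) :
  (forall i, S (fun x => v x i)) -> S (fun x => P.@[v x]).
Proof.
have [Sc _ SM _ Seq] := ringS => vS.
apply: Seq (_ : S (fun x => \sum_(m <- msupp P) P@_m * \prod_i v x i ^+ m i)) _.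
  apply: function_ring_sum => m; apply: SM (Sc _) _.
  by apply: function_ring_prod => i; apply: function_ring_exp.
by move=> x _; rewrite mevalE.
Qed.

Lemma coords_entry (i : 'I_(2 * 2 + 2 * 2)) :
  (exists k l, forall p : SL2xSL2 F, coords p i = SL2_mx p.1 k l) \/
  (exists k l, forall p : SL2xSL2 F, coords p i = SL2_mx p.2 k l).
Proof.
have [j ->|j ->] := split_ordP i; case/mxvec_indexP: j => k l.
  by left; exists k, l => p; rewrite /coords row_mxEl mxvecE.
by right; exists k, l => p; rewrite /coords row_mxEr mxvecE.
Qed.

Lemma function_ring_coords (h h' : X -> SL2 F) i :
  SL2_valued S h -> SL2_valued S h' ->
  S (fun x => coords (h x, h' x : SL2 F) i).
Proof.
have [_ _ _ _ Seq] := ringS => Sh Sh'.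
by case: (coords_entry i) => -[k [l kl]]; [apply: Seq (Sh k l) _|apply: Seq (Sh' k l) _];
  move=> x _; rewrite kl.
Qed.

End FunctionRings.

(** * Irreducibility from rational curves *)

Section RationalCurves.
Variable F : numFieldType.
Implicit Types (D : {poly F}) (X Y K : set (SL2 F)) (x y g : SL2 F).

Lemma eq_regular D (f g : F -> F) :
  (forall t, D.[t] != 0 -> f t = g t) -> regular D g -> regular D f.
Proof.
move=> fg [p [q H]]; exists p, q => t Dt; rewrite fg //.
exact: H.
Qed.

Lemma regular_ring D : function_ring [set t | D.[t] != 0] (regular D).
Proof.
split.
- exact: regular_cst.
- by move=> f f'; apply: regularD.
- by move=> f f'; apply: regularM.
- by move=> f; apply: regularN.
- by move=> f f' Rf ff'; apply: eq_regular ff' Rf.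
Qed.

Definition regular_curve D (c : F -> SL2 F) := SL2_valued (regular D) c.

Lemma regular_curve_sub D D' c : (forall t, D'.[t] != 0 -> D.[t] != 0) ->
  regular_curve D c -> regular_curve D' c.
Proof. by move=> DD' Rc i j; apply: regular_sub (Rc i j). Qed.

(** The points x and y are joined inside X by a rational curve, defined where D
    does not vanish and in particular at the parameters 0 and 1. *)
Definition joined_in X x y := exists D c,
  (D.[0] != 0 /\ D.[1] != 0) /\
  [/\ regular_curve D c, c 0 = x, c 1 = y & forall t, D.[t] != 0 -> X (c t)].

Definition rationally_connected X :=
  X !=set0 /\ forall x y, X x -> X y -> joined_in X x y.

Lemma rationally_connected_set1 x : rationally_connected [set x].
Proof.
split=> [|_ _ -> ->]; first by exists x.
exists 1, (fun=> x); rewrite !hornerC oner_eq0; split=> //; split=> //.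
exact: SL2_valued_cst (regular_ring _) _.
Qed.

(** The two curves are multiplied on the intersection of their domains. *)
Lemma rationally_connectedM X Y :
  rationally_connected X -> rationally_connected Y ->
  rationally_connected [set (x * y)%g | x in X & y in Y].
Proof.
move=> [[x0 Xx0] XP] [[y0 Yy0] YP]; split=> [|_ _ [x Xx [y Yy <-]] [x' Xx' [y' Yy' <-]]].
  by exists (x0 * y0)%g, x0 => //; exists y0.
have [D [c [[D0 D1] [Rc <- <- Xc]]]] := XP x x' Xx Xx'.
have [D' [c' [[D'0 D'1] [Rc' <- <- Yc']]]] := YP y y' Yy Yy'.
exists (D * D'), (fun t => c t * c' t)%g; rewrite !hornerM !mulf_neq0 //.
split=> //; split=> // [|t].
  apply: (SL2_valuedM (regular_ring _));
    [apply: regular_curve_sub Rc|apply: regular_curve_sub Rc'];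
    by move=> t; rewrite hornerM mulf_eq0 negb_or => /andP[].
rewrite hornerM mulf_eq0 negb_or => /andP[Dt D't].
exists (c t); first exact: Xc.
by exists (c' t); first exact: Yc'.
Qed.

Lemma rationally_connected_left_translate h X :
  rationally_connected X -> rationally_connected (left_translate h X).
Proof.
move=> rcX; rewrite (_ : left_translate h X = [set (x * y)%g | x in [set h] & y in X]).
  exact: rationally_connectedM (rationally_connected_set1 h) rcX.
apply/seteqP; split=> [_ [x Xx <-]|_ [_ -> [x Xx <-]]]; last by exists x.
by exists h => //; exists x.
Qed.

Definition segment (a b : F) : {poly F} := a%:P + (b - a) *: 'X.

Lemma segment0 a b : (segment a b).[0] = a.
Proof. by rewrite /segment hornerD hornerZ hornerX hornerC mulr0 addr0. Qed.

Lemma segment1 a b : (segment a b).[1] = b.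
Proof. by rewrite /segment hornerD hornerZ hornerX hornerC mulr1 addrC subrK. Qed.

Lemma rationally_connected_upper : rationally_connected (range (@upper F)).
Proof.
split=> [|_ _ [a _ <-] [b _ <-]]; first by exists (upper 0), 0.
exists 1, (fun t => upper (segment a b).[t]).
rewrite !hornerC oner_eq0 segment0 segment1; split=> //; split=> //.
apply: (SL2_valued_upper (regular_ring _)); exact: regular_poly.
Qed.

Lemma rationally_connected_lower : rationally_connected (range (@lower F)).
Proof.
split=> [|_ _ [a _ <-] [b _ <-]]; first by exists (lower 0), 0.
exists 1, (fun t => lower (segment a b).[t]).
rewrite !hornerC oner_eq0 segment0 segment1; split=> //; split=> //.
apply: (SL2_valued_lower (regular_ring _)); exact: regular_poly.
Qed.

Lemma rationally_connected_torus : rationally_connected (@torus F).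
Proof.
rewrite torus_diag; split=> [|_ _ [a a0 <-] [b b0 <-]].
  by exists (diag 1), 1 => //=; rewrite oner_eq0.
exists (segment a b), (fun t => diag (segment a b).[t]).
rewrite segment0 segment1; split=> //; split=> // [|t Dt]; last by exists (segment a b).[t].
apply: (SL2_valued_diag (regular_ring _)) => //; first exact: regular_poly.
by apply: regularV (regular_poly _ _).
Qed.

Lemma rationally_connected_borel : rationally_connected (@borel F).
Proof.
rewrite borel_diag_upper -torus_diag; apply: rationally_connectedM.
  exact: rationally_connected_torus.
exact: rationally_connected_upper.
Qed.

Lemma rationally_connected_SL2 : rationally_connected [set: SL2 F].
Proof.
rewrite SL2_elementary.
by do ![exact: rationally_connected_upper | exact: rationally_connected_lower
       | apply: rationally_connectedM].
Qed.

Definition conj_orbit K X Y : set (SL2xSL2 F) :=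
  \bigcup_(g in K) (conj_set g X `*` conj_set g Y).

Lemma conj_orbitP K X Y p : conj_orbit K X Y p <->
  exists g x y, [/\ K g, X x, Y y & p = (g * x * g^-1, g * y * g^-1)%g].
Proof.
split=> [[g Kg [[x Xx px] [y Yy py]]]|[g [x [y [Kg Xx Yy ->]]]]].
  by exists g, x, y; split=> //; rewrite px py; case: (p).
by exists g => //; split; [exists x|exists y].
Qed.

(** Suppose that two closed sets cover the orbit, P1 being an equation of the
    first that fails at p and P2 an equation of the second that fails at q. Along
    a rational curve from p to q the product of P1 and P2 vanishes, hence so does
    the product of their numerators, and one of them is the zero polynomial:
    that contradicts its value at the parameter 0 or 1. *)
Lemma conj_orbit_irreducible K X Y :
  rationally_connected K -> rationally_connected X -> rationally_connected Y ->
  irreducible_set (conj_orbit K X Y).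
Proof.
move=> [[g0 Kg0] KP] [[x0 Xx0] XP] [[y0 Yy0] YP]; split.
  by exists (g0 * x0 * g0^-1, g0 * y0 * g0^-1)%g; apply/conj_orbitP; exists g0, x0, y0.
move=> C1 C2 /zariski_closedP [S1 ->] /zariski_closedP [S2 ->] sub.
apply: contrapT => /not_orP[].
move=> /existsNP [p /not_implyP [/conj_orbitP [g [x [y [Kg Xx Yy pE]]]]]].
move=> /existsNP [P1 /not_implyP [SP1 P1p]].
move=> /existsNP [q /not_implyP [/conj_orbitP [g' [x' [y' [Kg' Xx' Yy' qE]]]]]].
move=> /existsNP [P2 /not_implyP [SP2 P2q]].
have [D1 [c1 [[D10 D11] [R1 c10 c11 X1]]]] := KP g g' Kg Kg'.
have [D2 [c2 [[D20 D21] [R2 c20 c21 X2]]]] := XP x x' Xx Xx'.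
have [D3 [c3 [[D30 D31] [R3 c30 c31 X3]]]] := YP y y' Yy Yy'.
pose D := D1 * D2 * D3.
have DE t : D.[t] != 0 -> [/\ D1.[t] != 0, D2.[t] != 0 & D3.[t] != 0].
  by rewrite !hornerM !mulf_eq0 !negb_or => /andP[/andP[]].
have {}R1 : regular_curve D c1 by apply: regular_curve_sub R1 => t /DE[].
have {}R2 : regular_curve D c2 by apply: regular_curve_sub R2 => t /DE[].
have {}R3 : regular_curve D c3 by apply: regular_curve_sub R3 => t /DE[].
pose c t : SL2xSL2 F := (c1 t * c2 t * (c1 t)^-1, c1 t * c3 t * (c1 t)^-1)%g.
have Rc P : regular D (fun t => P.@[coords (c t)]).
  apply: (function_ring_meval (regular_ring D)) => i.
  by apply: (function_ring_coords (regular_ring D)); apply: (SL2_valued_conj (regular_ring D)).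
have [p1 [q1 H1]] := Rc P1; have [p2 [q2 H2]] := Rc P2.
have D0 : D.[0] != 0 by rewrite !hornerM !mulf_neq0.
have D1' : D.[1] != 0 by rewrite !hornerM !mulf_neq0.
(* the factor D accounts for the parameters outside the domain of the curve *)
have /eqP : p1 * p2 * D = 0; last first.
  rewrite 2!mulf_eq0 -orbA => /or3P[] /eqP E.
  - have [_] := H1 0 D0; rewrite E horner0 mul0r /c c10 c20 c30 -pE; exact: P1p.
  - have [_] := H2 1 D1'; rewrite E horner0 mul0r /c c11 c21 c31 -qE; exact: P2q.
  - by move: D0; rewrite E horner0 eqxx.

apply: poly_eq0_eval => t; rewrite hornerM.
have [->|Dt] := eqVneq D.[t] 0; first by rewrite mulr0.
have [n1 E1] := H1 t Dt; have [n2 E2] := H2 t Dt.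
suff /eqP -> : (p1 * p2).[t] == 0 by rewrite mul0r.
have [Dt1 Dt2 Dt3] := DE t Dt.
have /sub [/(_ P1 SP1)|/(_ P2 SP2)] : conj_orbit K X Y (c t).
- apply/conj_orbitP; exists (c1 t), (c2 t), (c3 t).
  by split; [apply: X1|apply: X2|apply: X3|].
- move/eqP; rewrite E1 mulf_eq0 invr_eq0 (negbTE n1) orbF hornerM => /eqP ->.
  by rewrite mul0r.
- move/eqP; rewrite E2 mulf_eq0 invr_eq0 (negbTE n2) orbF hornerM => /eqP ->.
  by rewrite mulr0.
Qed.

End RationalCurves.

(** * Algebraic independence along a chain of irreducible sets *)

Section AlgebraicIndependence.
Variable F : fieldType.

Lemma widen_lift_max n (i : 'I_n) : widen_ord (leqnSn n) i = lift ord_max i.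
Proof. by apply/val_inj; rewrite /= /bump leqNgt ltn_ord. Qed.

(** Evaluation may treat the last variable separately. *)
Lemma meval_muni n (P : {mpoly F[n.+1]}) (v : 'I_n.+1 -> F) :
  (map_poly (meval (fun i => v (lift ord_max i))) (muni P)).[v ord_max] =
  P.@[v].
Proof.
rewrite muniE raddf_sum /= horner_sum mevalE; apply: eq_bigr => m _.
rewrite -mul_polyC rmorphM /= map_polyC map_polyXn /= hornerM hornerC hornerXn.
rewrite mevalZ mevalX big_ord_recr /= -mulrA; congr (_ * (_ * _)).
by apply: eq_bigr => i _; rewrite mnmE widen_lift_max.
Qed.

Lemma muni_eq0 n (P : {mpoly F[n.+1]}) : muni P = 0 -> P = 0.
Proof.
move=> P0; apply/mpolyP => m; rewrite mcoeff0; apply/eqP; rewrite mcoeff_eq0.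
apply/negP => mP; move: (mP); rewrite -[_ \in _]negbK -mcoeff_eq0 => /negP[].
have := congr1 (fun p : {poly {mpoly F[n]}} =>
  (p`_(m ord_max))@_[multinom m (lift ord_max i) | i < n]) P0.
rewrite muniE coef_sum raddf_sum coef0 mcoeff0 /= => E; apply/eqP; rewrite -[RHS]E.
rewrite (bigD1_seq m) ?msupp_uniq //= big1 ?addr0.
  rewrite -mul_polyC coefCM coefXn eqxx mulr1 mcoeffZ mcoeffX.
  rewrite (_ : _ == _) ?mulr1 //; apply/eqP/mnmP => i.
  by rewrite !mnmE widen_lift_max.
move=> m' m'm; rewrite -mul_polyC coefCM coefXn.
have [Emax|] := eqVneq (m ord_max) (m' ord_max); last by rewrite mulr0 mcoeff0.
rewrite mulr1 mcoeffZ mcoeffX; case: eqP => [/mnmP Em|]; last by rewrite mulr0.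
case/eqP: m'm; apply/mnmP => i; have [j ->|->] := unliftP ord_max i => //.
by have := Em j; rewrite !mnmE widen_lift_max.
Qed.

Definition algebraically_independent (X : Type) (Z : set X) m
    (f : 'I_m -> X -> F) :=
  forall P : {mpoly F[m]}, (forall z, Z z -> P.@[f^~ z] = 0) -> P = 0.

Local Notation N := (2 * 2 + 2 * 2)%N.

Definition polyfun (P : {mpoly F[N]}) (z : SL2xSL2 F) : F := P.@[coords z].

Lemma closed_polyfun (P : {mpoly F[N]}) : closed [set z | polyfun P z = 0].
Proof.
apply/zariski_closedP; exists [set P]; apply/seteqP; split=> z /=.
  by move=> Pz Q ->.
by apply.
Qed.

Lemma irreducible_polyfunM (Z : set (SL2xSL2 F)) (P Q : {mpoly F[N]}) :
  irreducible_set Z -> (forall z, Z z -> polyfun P z * polyfun Q z = 0) ->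
  (forall z, Z z -> polyfun P z = 0) \/ (forall z, Z z -> polyfun Q z = 0).
Proof.
move=> [_ irrZ] PQ0.
case: (irrZ _ _ (@closed_polyfun P) (@closed_polyfun Q)) => [z /PQ0 /eqP|H|H].
- by rewrite mulf_eq0 => /orP[] /eqP; [left|right].
- by left.
- by right.
Qed.

(** The new member is the last one, which is the variable singled out by muni. *)
Definition extend_family (X : Type) m (f : 'I_m -> X) (g : X) (i : 'I_m.+1) :=
  if unlift ord_max i is Some j then f j else g.

(** Take a relation on Z' between the P i and Q, as a polynomial in Q. Since Z' is
    irreducible and Q is not identically zero on it, the highest power of Q
    dividing the relation can be cancelled. On Z, where Q = 0, the constant
    coefficient of what remains is then a relation between the P i alone, so it
    is zero, against the choice of the power. *)
Lemma algebraically_independent_extend (Z Z' : set (SL2xSL2 F)) m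
    (P : 'I_m -> {mpoly F[N]}) (Q : {mpoly F[N]}) :
  irreducible_set Z' -> Z `<=` Z' ->
  algebraically_independent Z (polyfun \o P) ->
  (forall z, Z z -> polyfun Q z = 0) ->
  ~ (forall z, Z' z -> polyfun Q z = 0) ->
  algebraically_independent Z' (polyfun \o extend_family P Q).
Proof.
move=> irrZ' ZZ' indep Q0 QN0 R R0; apply: muni_eq0.
pose subst (p : {poly {mpoly F[m]}}) :=
  (map_poly (comp_mpoly [tuple P i | i < m]) p).[Q].
have substE p z : polyfun (subst p) z =
    (map_poly (meval (fun i => polyfun (P i) z)) p).[polyfun Q z].
  rewrite /subst /polyfun -horner_map -map_poly_comp; congr (_.[_]).
  apply: eq_map_poly => q /=; rewrite comp_mpoly_meval.
  by apply: meval_eq => i; rewrite tnth_map tnth_ord_tuple.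
have subst0 z : Z' z -> polyfun (subst (muni R)) z = 0.
  move=> Z'z; rewrite substE -[RHS](R0 z Z'z) -meval_muni.
  rewrite /extend_family /= unlift_none; congr (_.[_]); apply: eq_map_poly => q.
  by apply: meval_eq => i; rewrite /= liftK.
have [k [q + Rq]] := multiplicity_XsubC (muni R) 0.
apply: contraPP => /eqP -> /= => /negP; apply; rewrite /root.
have q0 z : Z' z -> polyfun (subst q) z = 0.
  move: z.
  have [//|/QN0[]] : (forall z, Z' z -> polyfun (subst q) z = 0) \/
      (forall z, Z' z -> polyfun Q z = 0).
  have [|//|Qk] := @irreducible_polyfunM Z' (subst q) (Q ^+ k) irrZ'.
  - move=> z Z'z; rewrite -(subst0 z Z'z) Rq subr0 !substE.
    by rewrite rmorphM /= map_polyXn hornerM hornerXn /polyfun rmorphXn.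
  - by left.
  - right => z /Qk /eqP; rewrite /polyfun rmorphXn expf_eq0 => /andP[_].
    by move/eqP.
apply/eqP; rewrite horner_coef0; apply: indep => z Zz.
by rewrite -[RHS](q0 z (ZZ' z Zz)) substE Q0 // horner_coef0 coef_map.
Qed.

End AlgebraicIndependence.

(** * Algebraic dependence by counting monomials *)

Section ParameterCount.
Variable F : fieldType.

Lemma msize_mulD n (p q : {mpoly F[n]}) a b :
  (msize p <= a.+1)%N -> (msize q <= b.+1)%N -> (msize (p * q) <= (a + b).+1)%N.
Proof.
move=> pa qb; have [->|pN0] := eqVneq p 0; first by rewrite mul0r msize0.
have [->|qN0] := eqVneq q 0; first by rewrite mulr0 msize0.
by rewrite msizeM // -subn1 leq_subLR add1n -addnS -addSn leq_add.
Qed.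

Lemma msize_expM n (p : {mpoly F[n]}) a k :
  (msize p <= a.+1)%N -> (msize (p ^+ k) <= (k * a).+1)%N.
Proof.
move=> pa; elim: k => [|k IHk]; first by rewrite expr0 msize1.
by rewrite exprS mulSn msize_mulD.
Qed.

Lemma msize_prodM n m (p : 'I_m -> {mpoly F[n]}) a :
  (forall j, msize (p j) <= a.+1)%N -> (msize (\prod_j p j) <= (m * a).+1)%N.
Proof.
elim: m p => [|m IHm] p pa; first by rewrite big_ord0 msize1.
by rewrite big_ord_recl mulSn msize_mulD // IHm.
Qed.

Lemma card_bmultinom n k : (#|{: 'X_{1..n < k.+1}}| <= k.+1 ^ n)%N.
Proof.
rewrite -[X in (_ <= _ ^ X)%N](card_ord n) -[X in (_ <= X ^ _)%N](card_ord k.+1).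
rewrite -card_ffun.
pose g (m : 'X_{1..n < k.+1}) : {ffun 'I_n -> 'I_k.+1} := [ffun i => inord (m i)].
have lt_m (m : 'X_{1..n < k.+1}) i : (m i < k.+1)%N.
  apply: leq_ltn_trans (bmdeg m); rewrite mdegE (bigD1 i) //=.
  exact: leq_addr.
apply: (@leq_card _ _ g) => m m' /ffunP E; apply/val_inj/mnmP => i /=.
by have := congr1 val (E i); rewrite !ffunE /= !inordK.
Qed.

Lemma kernel_row m n (A : 'M[F]_(m, n)) : (n < m)%N ->
  exists2 c : 'rV[F]_m, c != 0 & c *m A = 0.
Proof.
move=> nm; have : kermx A != 0.
  rewrite kermx_eq0 /row_free; apply: contraTneq nm => <-.
  by rewrite -leqNgt rank_leq_col.
by case/rowV0Pn => c /sub_kermxP cA cN0; exists c.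
Qed.

(** A polynomial in m variables of degree below N in each has N^m coefficients,
    while its value at m polynomials of degree at most e in n variables has degree
    at most m N e, hence at most (m N e + 1)^n coefficients. *)
Lemma parameter_count n m e : (n < m)%N -> exists N, ((m * N * e).+1 ^ n < N ^ m)%N.
Proof.
move=> nm; set N := ((m * e).+1 ^ n).+1; exists N.
have N0 : (0 < N)%N by [].
apply: leq_trans (leq_pexp2l N0 nm); rewrite expnS.
apply: (@leq_ltn_trans (((m * e).+1 * N) ^ n)).
  have [->|n0] := posnP n; first by rewrite !expn0.
  by rewrite leq_exp2r // mulnAC mulSn -addn1 addnC leq_add2r.
by rewrite expnMn ltn_pmul2r ?expn_gt0.
Qed.

(** Any m > n quotients of polynomials in n variables with the common denominator
    h are algebraically dependent, by linear algebra: multiplied by h^(m N), the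
    monomials of degree below N in each quotient become the polynomials Q below,
    which are too many to be linearly independent. *)
Lemma parametrized_dependent n m (h : {mpoly F[n]}) (G : 'I_m -> {mpoly F[n]}) :
  (n < m)%N -> exists2 P : {mpoly F[m]}, P != 0 &
    forall v (f : 'I_m -> F), h.@[v] != 0 ->
      (forall j, h.@[v] * f j = (G j).@[v]) -> P.@[f] = 0.
Proof.
move=> nm.
pose e := maxn (msize h) (\max_j msize (G j)).
have [N ltN] := parameter_count e nm.
pose I := {ffun 'I_m -> 'I_N}.
pose Q (a : I) := \prod_j (G j ^+ a j * h ^+ (N - a j)).
have he : (msize h <= e.+1)%N by rewrite leqW // leq_maxl.
have Ge j : (msize (G j) <= e.+1)%N.
  by rewrite leqW // leq_max (leq_bigmax j) orbT.
have Qsize a : (msize (Q a) <= (m * N * e).+1)%N.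
  rewrite -mulnA; apply: msize_prodM => j.
  rewrite -[X in (X * e)%N](subnKC (ltnW (ltn_ord (a j)))) mulnDl.
  by rewrite msize_mulD // msize_expM.
set M := (m * N * e)%N in ltN Qsize.
pose J := 'X_{1..n < M.+1}.
pose A := \matrix_(i < #|{: I}|, j < #|{: J}|) (Q (enum_val i))@_(enum_val j).
have [|c cN0 cA] := @kernel_row _ _ A.
  by rewrite card_ffun !card_ord (leq_ltn_trans (card_bmultinom _ _)).
pose mon (a : I) : 'X_{1..m} := [multinom (a j : nat) | j < m].
have mon_inj : injective mon.
  move=> a b /mnmP E; apply/ffunP => j; apply/val_inj.
  by have := E j; rewrite !mnmE.
exists (\sum_i c 0 i *: 'X_[mon (enum_val i)]).
  have /rV0Pn [i ci] := cN0; apply: contraNneq ci => E.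
  have := congr1 (mcoeff (mon (enum_val i))) E.
  rewrite raddf_sum mcoeff0 /= (bigD1 i) //= big1 ?addr0 => [|i' i'i].
    by rewrite mcoeffZ mcoeffX eqxx mulr1 => ->.
  rewrite mcoeffZ mcoeffX; case: eqP => [/mon_inj/enum_val_inj E'|].
    by case/eqP: i'i.
  by rewrite mulr0.
have cQ : \sum_i c 0 i *: Q (enum_val i) = 0.
  apply/mpolyP => k; rewrite raddf_sum mcoeff0 /=.
  have [kM|kM] := ltnP (mdeg k) M.+1.
    have := congr1 (fun B : 'rV_#|{: J}| => B 0 (enum_rank (BMultinom kM))) cA.
    rewrite !mxE => E; rewrite -[RHS]E; apply: eq_bigr => i _.
    by rewrite mcoeffZ !mxE enum_rankK.
  rewrite big1 // => i _; rewrite mcoeffZ.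
  rewrite (_ : _@_k = 0) ?mulr0 //; apply/eqP; rewrite mcoeff_eq0.
  by apply: msize_mdeg_ge; apply: leq_trans kM; apply: Qsize.
move=> v f hv hf; have hN : h.@[v] ^+ (m * N) != 0 by rewrite expf_neq0.
apply: (mulfI hN); rewrite mulr0 raddf_sum mulr_sumr /=.
have := congr1 (meval v) cQ; rewrite raddf_sum meval0 /= => E.
rewrite -[RHS]E; apply: eq_bigr => i _; rewrite !mevalZ mulrCA mevalX.
congr (_ * _); rewrite rmorph_prod /= mulnC exprM -[X in _ ^+ X]card_ord.
rewrite -prodr_const -big_split /=; apply: eq_bigr => j _.
rewrite rmorphM !rmorphXn /= -hf exprMn mnmE mulrAC -exprD.
by rewrite subnKC // ltnW.
Qed.

End ParameterCount.

(** * Chains in a parametrized set *)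

Section DimensionBound.
Variable F : fieldType.
Local Notation N := (2 * 2 + 2 * 2)%N.

(** Each strict step contributes an equation of the smaller set that fails on the
    larger one. *)
Lemma irreducible_chain_independent (A : set (SL2xSL2 F)) n :
  has_irreducible_chain A n ->
  exists P : 'I_n -> {mpoly F[N]},
    algebraically_independent A (fun i => polyfun (P i)).
Proof.
case=> Z [ZP Zlt].
suff [P indep] : exists P : 'I_n -> {mpoly F[N]},
    algebraically_independent (Z n) (fun i => polyfun (P i)).
  exists P => Q Q0; apply: indep => z; have [_ [C _ ->]] := ZP n (leqnn n).
  by case=> /Q0.
have {ZP Zlt} := (ZP, Zlt); elim: n => [|n IHn] [ZP Zlt].
  have [[[z Zz] _] _] := ZP 0%N (leqnn 0); exists (fun=> 0) => Q Q0.
  suff QC : Q = (Q@_0)%:MP by have := Q0 z Zz; rewrite QC mevalC => ->; rewrite mpolyC0.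
  apply/mpolyP => m; have -> : m = 0%MM by apply/mnmP; case.
  by rewrite mcoeffC eqxx mulr1.
have [P indep] := IHn (conj (fun i le_in => ZP i (leqW le_in))
                            (fun i lt_in => Zlt i (leqW lt_in))).
have [irrZ' _] := ZP n.+1 (leqnn _).
have [_ [C /zariski_closedP [S CS] ZC]] := ZP n (leqnSn n).
have [_ [C' _ ZC']] := ZP n.+1 (leqnn _).
have [ZZ' Z'Z] := Zlt n (leqnn _).
have [Q SQ QN0] : exists2 Q, S Q & ~ (forall z, Z n.+1 z -> polyfun Q z = 0).
  apply: contrapT => H; apply: Z'Z => z Z'z; rewrite ZC; split.
    by move: Z'z; rewrite ZC' => -[].
  rewrite CS => Q SQ; apply: contrapT => Qz; apply: H; exists Q => // Q0.
  exact/Qz/Q0.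
exists (extend_family P Q).
apply: (algebraically_independent_extend irrZ' ZZ' indep _ QN0) => z.
by rewrite ZC CS => -[_]; apply.
Qed.

(** Membership in the ring of polynomials with h inverted, seen on the locus h <> 0. *)
Definition localized n (h : {mpoly F[n]}) (f : ('I_n -> F) -> F) :=
  exists k P, forall v, h.@[v] != 0 -> h.@[v] ^+ k * f v = P.@[v].

Lemma localized_ring n (h : {mpoly F[n]}) :
  function_ring [set v | h.@[v] != 0] (localized h).
Proof.
split=> [a|f f' [k [P fP]] [k' [P' fP']]|f f' [k [P fP]] [k' [P' fP']]
        |f [k [P fP]]|f f' [k [P fP]] ff'].
- by exists 0%N, a%:MP => v _; rewrite expr0 mul1r mevalC.
- exists (k + k')%N, (h ^+ k' * P + h ^+ k * P') => v hv.
  by rewrite mevalD !mevalM !rmorphXn /= -fP // -fP' // exprD; ring.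
- exists (k + k')%N, (P * P') => v hv.
  by rewrite mevalM -fP // -fP' // exprD; ring.
- by exists k, (- P) => v hv; rewrite mulrN mevalN fP.
- by exists k, P => v hv; rewrite ff' // fP.
Qed.

Lemma localized_dependent n m (h : {mpoly F[n]}) (f : 'I_m -> ('I_n -> F) -> F) :
  (n < m)%N -> (forall j, localized h (f j)) ->
  exists2 P : {mpoly F[m]}, P != 0 &
    forall v, h.@[v] != 0 -> P.@[f^~ v] = 0.
Proof.
move=> nm /choice [k] /choice [G fG].
pose d := (\max_j k j)%N.
have [P PN0 P0] := parametrized_dependent (h ^+ d)
  (fun j => h ^+ (d - k j) * G j) nm.
exists P => // v hv; apply: (P0 v) => [|j]; first by rewrite rmorphXn expf_neq0.
rewrite mevalM -fG // !rmorphXn /= mulrA -exprD subnK //.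
exact: (leq_bigmax j).
Qed.

(** Dependence of the coordinates along the parametrization of S is a polynomial
    equation, so it passes to the closure of S. *)
Lemma parametrized_chain_bound (A S : set (SL2xSL2 F)) n (h : {mpoly F[n]})
    (E : ('I_n -> F) -> SL2xSL2 F) m :
  A `<=` closure S ->
  (forall i, localized h (fun v => coords (E v) i)) ->
  (forall z, S z -> exists2 v, h.@[v] != 0 & z = E v) ->
  has_irreducible_chain A m -> (m <= n)%N.
Proof.
move=> AS EP SE /irreducible_chain_independent [P indep].
rewrite leqNgt; apply/negP => nm.
have [j|Q /eqP QN0 Q0] := localized_dependent nm (h := h)
    (f := fun j v => polyfun (P j) (E v)).
  exact: (function_ring_meval (localized_ring h)).
apply/QN0/indep => z Az.
pose R := comp_mpoly [tuple P j | j < m] Q.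
have RE y : polyfun R y = Q.@[fun j => polyfun (P j) y].
  rewrite /polyfun comp_mpoly_meval; apply: meval_eq => j.
  by rewrite tnth_map tnth_ord_tuple.
rewrite -RE; apply: (closure_sub (@closed_polyfun F R) _ (AS z Az)) => y Sy /=.
by have [v hv ->] := SE y Sy; rewrite RE; apply: Q0.
Qed.

End DimensionBound.

(** * The commutator trace and the cubic form *)

Section TraceForms.
Variable F : fieldType.
Implicit Types (x y g : SL2 F) (p : SL2xSL2 F).

Definition commutator x y : SL2 F := (x * y * x^-1 * y^-1)%g.

Definition commutator_trace x y : F := tr (commutator x y).

Lemma commutator_traceC x y : commutator_trace x y = commutator_trace y x.
Proof.
rewrite /commutator_trace /commutator -(SL2_trV (_ * _)%g) !invgM !invgK.
by rewrite !mulgA.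
Qed.

(** The third factor of tr w - 2; see SL2_tr_word. *)
Definition cubic_form x y : F :=
  tr x * tr y * tr (x * y)%g - tr y ^+ 2 - tr (x * y)%g ^+ 2.

Lemma conj_mul g x y : (g * x * g^-1 * (g * y * g^-1))%g = (g * (x * y) * g^-1)%g.
Proof. by rewrite -!mulgA mulKg. Qed.

Lemma conj_inv g x : ((g * x * g^-1)^-1 = g * x^-1 * g^-1)%g.
Proof. by rewrite !invgM invgK mulgA. Qed.

Lemma commutator_conj g x y :
  commutator (g * x * g^-1)%g (g * y * g^-1)%g = (g * commutator x y * g^-1)%g.
Proof. by rewrite /commutator !conj_inv !conj_mul. Qed.

Lemma commutator_trace_conj g x y :
  commutator_trace (g * x * g^-1)%g (g * y * g^-1)%g = commutator_trace x y.
Proof. by rewrite /commutator_trace commutator_conj SL2_trJ. Qed.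

Lemma cubic_form_conj g x y :
  cubic_form (g * x * g^-1)%g (g * y * g^-1)%g = cubic_form x y.
Proof. by rewrite /cubic_form conj_mul !SL2_trJ. Qed.

Lemma commutator_trace_diag l y : l != 0 ->
  commutator_trace (diag l) y = 2 - (l - l^-1) ^+ 2 * (e12 y * e21 y).
Proof.
move=> l0; rewrite -[2]mulr1 -[X in 2 * X](SL2_detE y) /commutator_trace /commutator.
by rewrite SL2_trE !SL2E !diagE //; field.
Qed.

(** The form factors as - (u - l t) (u - t / l), and the two factors are multiples
    of y_22 and of y_11. *)
Lemma cubic_form_diag l y : l != 0 ->
  cubic_form (diag l) y = (l - l^-1) ^+ 2 * (e11 y * e22 y).
Proof.
by move=> l0; rewrite /cubic_form !SL2_trE !SL2E !diagE //; field.
Qed.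

(** With a = 1 or a = -1, these are the upper triangular matrices of trace 2 or -2. *)
Definition parabolic (a b : F) : SL2 F := mkSL2 a b 0 a.

Lemma parabolicE a b : a ^+ 2 = 1 -> (e11 (parabolic a b) = a) *
  (e12 (parabolic a b) = b) * (e21 (parabolic a b) = 0) * (e22 (parabolic a b) = a).
Proof. by move=> a2; rewrite !mkSL2E -?expr2 ?mulr0 ?subr0. Qed.

Lemma commutator_trace_parabolic a b y : a ^+ 2 = 1 ->
  commutator_trace (parabolic a b) y = 2 + (b * e21 y) ^+ 2.
Proof.
move=> a2; have -> : 2 = 2 * a ^+ 2 * (e11 y * e22 y - e12 y * e21 y).
  by rewrite a2 SL2_detE !mulr1.
rewrite /commutator_trace /commutator SL2_trE !SL2E !parabolicE //; ring.
Qed.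

Lemma cubic_form_parabolic a b y : a ^+ 2 = 1 ->
  cubic_form (parabolic a b) y = - (b * e21 y) ^+ 2.
Proof.
move=> a2; transitivity ((a ^+ 2 - 1) * (e11 y + e22 y) ^+ 2 - (b * e21 y) ^+ 2).
  by rewrite /cubic_form !SL2_trE !SL2E !parabolicE //; ring.
by rewrite a2 subrr mul0r add0r.
Qed.

Lemma antidiag_diagJ l : l != 0 ->
  (antidiag 1 * diag l * (antidiag 1)^-1)%g = diag l^-1 :> SL2 F.
Proof.
move=> l0; have lV0 : l^-1 != 0 by rewrite invr_eq0.
apply: SL2_eq; rewrite !SL2E !(antidiagE (oner_neq0 _)) !diagE //; field;
  by rewrite ?oner_neq0 l0.
Qed.

Lemma conj_by g x : x = (g * (g^-1 * x * g) * g^-1)%g.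
Proof. by rewrite !mulgA mulgV mul1g mulgK. Qed.

Lemma conj_exists g y : exists y', y = (g * y' * g^-1)%g.
Proof. by exists (g^-1 * y * g)%g; apply: conj_by. Qed.

End TraceForms.

(** * Normal forms up to conjugacy *)

Section ClosedField.
Variable F : numClosedFieldType.
Implicit Types (x y g : SL2 F) (p : SL2xSL2 F).

(** Over an algebraically closed field a matrix has an eigenvector. *)
Lemma conj_borel x : exists g b, borel b /\ x = (g * b * g^-1)%g.
Proof.
(* a lower triangular matrix: the second basis vector is an eigenvector *)
have [x12|x12] := eqVneq (e12 x) 0.
  exists (antidiag 1), ((antidiag 1)^-1 * x * antidiag 1)%g; split; last exact: conj_by.
  apply/borelP; rewrite !SL2E !(antidiagE (oner_neq0 _)) x12; ring.
(* otherwise (1, z) is an eigenvector, where z solves a quadratic equation *)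
pose d := sqrtC ((e11 x - e22 x) ^+ 2 + 4 * e12 x * e21 x).
have d2 : d ^+ 2 = (e11 x - e22 x) ^+ 2 + 4 * e12 x * e21 x by apply: sqrtCK.
pose z := (e22 x - e11 x + d) / (2 * e12 x).
exists (lower z), ((lower z)^-1 * x * lower z)%g; split; last exact: conj_by.
apply/borelP; rewrite !SL2E !lowerE.
apply: (mulfI (_ : 4 * e12 x != 0)); first by rewrite mulf_neq0 ?pnatr_eq0.
rewrite mulr0; transitivity ((e11 x - e22 x) ^+ 2 + 4 * e12 x * e21 x - d ^+ 2).
  by rewrite /z; field; rewrite x12.
by rewrite d2 subrr.
Qed.

Lemma conj_normal_form x :
  (exists g l, [/\ l != 0, l - l^-1 != 0 & x = (g * diag l * g^-1)%g]) \/
  (exists g a b, a ^+ 2 = 1 /\ x = (g * parabolic a b * g^-1)%g).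
Proof.
have [g [b [Bb ->]]] := conj_borel x.
have b11 := borel_e11_neq0 Bb; move/borelP: Bb => b21.
have b22 := e22_inv (or_intror b21); set l := e11 b in b11 b22 *.
have [lV|lV] := eqVneq (l - l^-1) 0.
  right; exists g, l, (e12 b); have l2 : l ^+ 2 = 1.
    by move/eqP: lV; rewrite subr_eq0 => /eqP lV; rewrite expr2 {2}lV mulfV.
  split=> //; congr (_ * _ * _)%g; apply: SL2_eq; rewrite !parabolicE //.
  by rewrite b22; move/eqP: lV; rewrite subr_eq0 => /eqP.
(* with distinct eigenvalues a unipotent conjugation removes the (1,2) entry *)
left; pose u := upper (- e12 b / (l - l^-1)) : SL2 F.
exists (g * u)%g, l; split=> //.
suff -> : b = (u * diag l * u^-1)%g by rewrite !invgM !mulgA.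
apply: SL2_eq; rewrite !SL2E !upperE !diagE // ?b21 ?b22 -?/l; try by ring.
transitivity (- (- e12 b / (l - l^-1)) * (l - l^-1)); last by ring.
by rewrite -!mulNr opprK divfK.
Qed.

End ClosedField.

(** * The nontrivial coset of the torus in its normalizer *)

Section WeylElement.
Variable F : numClosedFieldType.
Implicit Types (x y g dw : SL2 F).

(** The coset of the torus by any element of its normalizer outside it. *)
Definition antitorus : set (SL2 F) := [set y | e11 y = 0 /\ e22 y = 0].

Lemma two_neq0 : 2 != 0 :> F. Proof. by rewrite pnatr_eq0. Qed.

Lemma diag2_sub_neq0 : 2 - 2^-1 != 0 :> F.
Proof.
rewrite subr_eq0; apply/eqP => E; have := congr1 ( *%R 2) E.
by rewrite mulfV ?two_neq0 // => /eqP; rewrite -natrM pnatr_eq1.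
Qed.

Lemma antitorus_tr y : antitorus y -> tr y = 0.
Proof. by move=> [y11 y22]; rewrite SL2_trE y11 y22 addr0. Qed.

(** Conjugating diag(2, 1/2) into the torus forces x_11 x_12 = x_21 x_22 = 0, and
    then the determinant leaves only diagonal and antidiagonal matrices. *)
Lemma normalizer_torus_antitorus dw :
  (normalizer (@torus F) `\` @torus F) dw -> antitorus dw.
Proof.
move=> [ndw Tdw].
have : @torus F (dw * diag 2 * dw^-1)%g.
  rewrite -ndw; exists (diag 2) => //; apply/torusP; by rewrite !(diagE two_neq0).
move=> /torusP; rewrite !SL2E !(diagE two_neq0) => -[E12 E21].
move: E12 E21 (diag2_sub_neq0); move: (2^-1 : F) => c E12 E21 h.
have p12 : e11 dw * e12 dw = 0.
  apply: (mulfI h); rewrite mulr0 -[RHS]oppr0 -[X in _ = - X]E12; ring.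
have p21 : e21 dw * e22 dw = 0.
  apply: (mulfI h); rewrite mulr0 -[RHS]E21; ring.
have D := SL2_detE dw.
have x11 : e11 dw = 0.
  apply: contrapT => /eqP x11; apply: Tdw; apply/torusP.
  move/eqP: p12; rewrite mulf_eq0 (negbTE x11) => /eqP x12; split=> //.
  move/eqP: p21; rewrite mulf_eq0 => /orP[/eqP//|/eqP x22].
  by move/eqP: D; rewrite x12 x22 mulr0 mul0r subrr eq_sym oner_eq0.
split=> //; move/eqP: p21; rewrite mulf_eq0 => /orP[/eqP x21|/eqP//].
by move/eqP: D; rewrite x11 x21 mulr0 mul0r subrr eq_sym oner_eq0.
Qed.

Lemma left_translate_borel dw : antitorus dw ->
  left_translate dw (@borel F) = [set y | e11 y = 0].
Proof.
move=> [d11 d22]; apply/seteqP; split=> [_ [b /borelP b21 <-] /=|y /= y11].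
  by rewrite SL2E d11 b21; ring.
exists (dw^-1 * y)%g; last by rewrite mulVKg.
by apply/borelP; rewrite !SL2E d11 y11; ring.
Qed.

Lemma left_translate_torus dw : antitorus dw ->
  left_translate dw (@torus F) = antitorus.
Proof.
move=> [d11 d22]; apply/seteqP; split=> [_ [b /torusP [b12 b21] <-] /=|y /= [y11 y22]].
  by split; rewrite SL2E ?d11 ?d22 ?b12 ?b21; ring.
exists (dw^-1 * y)%g; last by rewrite mulVKg.
by apply/torusP; rewrite !SL2E d11 d22 y11 y22; split; ring.
Qed.

(** Both are diagonalizable with eigenvalues i and -i, which an antidiagonal
    matrix exchanges. *)
Lemma trace0_conj x y : tr x = 0 -> tr y = 0 -> exists g, y = (g * x * g^-1)%g.
Proof.
have form z : tr z = 0 -> exists g l, l ^+ 2 = -1 /\ z = (g * diag l * g^-1)%g.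
  case: (conj_normal_form z) => [[g [l [l0 _ ->]]]|[g [a [b [a2 ->]]]]].
    rewrite SL2_trJ SL2_trE !diagE // => E; exists g, l; split=> //.
    apply: (mulIf (_ : l^-1 != 0)); first by rewrite invr_eq0.
    by rewrite expr2 mulfK // mulN1r; apply/eqP; rewrite -addr_eq0 E.
  rewrite SL2_trJ SL2_trE !parabolicE // => /eqP.
  rewrite -mulr2n mulrn_eq0 /= => /eqP a0.
  by move/eqP: a2; rewrite a0 expr0n eq_sym oner_eq0.
move=> /form [g [l [l2 ->]]] /form [h [m [m2 ->]]].
have l0 : l != 0 by apply: contra_eq_neq l2 => ->; rewrite expr0n eq_sym oppr_eq0 oner_neq0.
have : (m - l) * (m + l) = 0 by rewrite -subr_sqr m2 l2 subrr.
move/eqP; rewrite mulf_eq0 => /orP[|].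
  rewrite subr_eq0 => /eqP ->; exists (h * g^-1)%g.
  by rewrite !invgM invgK !mulgA mulgVK -!mulgA mulKg.
rewrite addr_eq0 => /eqP ->; exists (h * antidiag 1 * g^-1)%g.
have <- : l^-1 = - l.
  by apply: (mulfI l0); rewrite mulfV // mulrN -expr2 l2 opprK.
by rewrite -antidiag_diagJ // !invgM invgK !mulgA mulgVK -!mulgA mulKg.
Qed.

Lemma conj_class_trace0 dw : antitorus dw -> conj_class dw = [set x | tr x = 0].
Proof.
move=> [d11 d22]; have d0 : tr dw = 0 by rewrite SL2_trE d11 d22 addr0.
apply/seteqP; split=> [_ [g _ <-] /=|x /= x0]; first by rewrite SL2_trJ.
by have [g ->] := trace0_conj d0 x0; exists g.
Qed.

End WeylElement.

(** * Pairs with commutator trace 2 *)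

Section Decomposition.
Variable F : numClosedFieldType.
Implicit Types (x y g dw : SL2 F).

Lemma conj_saturationP (X Y : set (SL2 F)) p : conj_saturation X Y p <->
  exists g x y, [/\ X x, Y y & p = (g * x * g^-1, g * y * g^-1)%g].
Proof.
by split=> [/conj_orbitP [g [x [y [_ Xx Yy ->]]]]|[g [x [y [Xx Yy ->]]]]];
  [|apply/conj_orbitP]; exists g, x, y.
Qed.

(** For diagonal x with distinct eigenvalues the condition reads y_12 y_21 = 0, so
    y is triangular, and conjugation by an antidiagonal matrix repairs the lower
    case; for x = +- a nontrivial unipotent it reads y_21 = 0; for central x
    triangularizing y suffices. *)
Lemma commutator_trace_sat_borel : [set p | commutator_trace p.1 p.2 = 2] =
  conj_saturation (@borel F) (@borel F).
Proof.
apply/seteqP; split=> [[x y] /= k2|p /conj_saturationP [g [x [y [Bx By ->]]]] /=].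
  apply/conj_saturationP; move: k2.
  have diag_borel l : l != 0 -> @borel F (diag l).
    by move=> l0; apply/borelP; rewrite diagE.
  case: (conj_normal_form x) => [[g [l [l0 ll ->]]]|[g [a [b [a2 ->]]]]];
    have [y' ->] := conj_exists g y; rewrite commutator_trace_conj.
    rewrite commutator_trace_diag // => /eqP; rewrite subr_eq addrC -subr_eq subrr.
    rewrite eq_sym !mulf_eq0 (negbTE ll) /= => /orP[]/eqP E.
      exists (g * (antidiag 1)^-1)%g, (diag l^-1), (antidiag 1 * y' * (antidiag 1)^-1)%g.
      split; first by apply: diag_borel; rewrite invr_eq0.
        by apply/borelP; rewrite !SL2E !(antidiagE (oner_neq0 _)) E; ring.
      rewrite -antidiag_diagJ //.
      congr (_, _); by rewrite !invgM !invgK !mulgA !mulgVK.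
    by exists g, (diag l), y'; split=> //; [exact: diag_borel|exact/borelP].
  rewrite commutator_trace_parabolic // -[RHS]addr0 => /addrI /eqP.
  rewrite expf_eq0 /= mulf_eq0 => /orP[]/eqP E; last first.
    exists g, (parabolic a b), y'.
    by split=> //; apply/borelP; rewrite ?parabolicE.
  have [h [c [Bc ->]]] := conj_borel y'.
  exists (g * h)%g, (parabolic a b), c; split=> //; first by apply/borelP; rewrite parabolicE.
  congr (_, _); last by rewrite !invgM !mulgA.
  rewrite invgM !mulgA; congr (_ * _)%g; rewrite -!mulgA; congr (_ * _)%g.
  suff -> : (parabolic a b * h^-1 = h^-1 * parabolic a b)%g by rewrite mulVKg.
  by apply: SL2_eq; rewrite !SL2E !parabolicE // ?E; ring.
rewrite commutator_trace_conj /commutator_trace /commutator SL2_trE !SL2E.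
move/borelP: (Bx) => x21; move/borelP: (By) => y21.
rewrite x21 y21 (e22_inv (or_intror x21)) (e22_inv (or_intror y21)).
by field; rewrite !borel_e11_neq0.
Qed.

End Decomposition.

(** * The word map *)

Section WordMap.
Variable F : numClosedFieldType.
Implicit Types (x y g dw : SL2 F).

Definition word_map x y : SL2 F :=
  commutator (commutator x y) (x * commutator x y * x^-1)%g.

Lemma word_map_conj g x y :
  word_map (g * x * g^-1)%g (g * y * g^-1)%g = (g * word_map x y * g^-1)%g.
Proof. by rewrite /word_map !(commutator_conj, conj_inv, conj_mul). Qed.

Lemma word_map_trace x y : tr (word_map x y) - 2 =
  tr x ^+ 2 * (commutator_trace x y - 2) ^+ 2 * cubic_form x y.
Proof. exact: SL2_tr_word. Qed.

Lemma commutator_eq1 x y : commutator x y = 1%g <-> (x * y = y * x)%g.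
Proof.
rewrite /commutator; split=> [E|->]; last by rewrite mulgK mulgV.
by apply: (mulIg x^-1%g); apply: (mulIg y^-1%g); rewrite E mulgK mulgV.
Qed.

(** On a pair of triangular matrices the commutator is unipotent, and unipotent
    triangular matrices commute. *)
Lemma commutator_trace2_word_map x y : commutator_trace x y = 2 -> word_map x y = 1%g.
Proof.
move=> k2; have /conj_saturationP [g [a [b [/borelP a21 /borelP b21 [-> ->]]]]] :
    conj_saturation (@borel F) (@borel F) (x, y).
  by rewrite -commutator_trace_sat_borel.
rewrite word_map_conj (_ : word_map a b = 1%g) ?mulg1 ?mulgV //.
have a11 := borel_e11_neq0 ((borelP a).2 a21).
have b11 := borel_e11_neq0 ((borelP b).2 b21).
have a22 := e22_inv (or_intror a21); have b22 := e22_inv (or_intror b21).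
have c21 : e21 (commutator a b) = 0.
  by rewrite /commutator !SL2E a21 b21; ring.
have c11 : e11 (commutator a b) = 1.
  rewrite /commutator !SL2E a21 b21 a22 b22; field.
  by rewrite a11 b11.
have c22 := e22_inv (or_intror c21); rewrite c11 invr1 in c22.
apply/commutator_eq1; move: (commutator a b) c21 c11 c22 => c c21 c11 c22.
by apply: SL2_eq; rewrite !SL2E ?a21 ?c21 ?c11 ?c22 ?a22; ring.
Qed.

(** A matrix of trace 0 satisfies x^2 = -1, which is central; hence x^-1 = - x and
    x [x,y] x^-1 = [x,y]^-1. *)
Lemma trace0_word_map x y : tr x = 0 -> word_map x y = 1%g.
Proof.
rewrite SL2_trE => /eqP; rewrite addr_eq0 => /eqP x11.
(* z is the scalar matrix -1 *)
pose z := (x^-1 * x^-1)%g; have D := SL2_detE x.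
have z12 : e12 z = 0 by rewrite !SL2E x11; ring.
have z21 : e21 z = 0 by rewrite !SL2E x11; ring.
have z11 : e11 z = -1 by rewrite !SL2E -D x11; ring.
have z22 : e22 z = -1 by rewrite !SL2E -D x11; ring.
have xV : (x^-1 = z * x)%g by rewrite /z mulgVK.
clearbody z.
have zC h : (z * h = h * z)%g.
  by apply: SL2_eq; rewrite !SL2_mulE ?z11 ?z12 ?z21 ?z22; ring.
have zz : (z * z = 1)%g.
  by apply: SL2_eq; rewrite !SL2_mulE !SL2_oneE ?z11 ?z12 ?z21 ?z22; ring.
apply/commutator_eq1; suff -> : (x * commutator x y * x^-1)%g = (commutator x y)^-1%g.
  by rewrite mulgV mulVg.
rewrite /commutator !invgM !invgK !mulgA.
have -> : (x * x = z)%g.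
  by apply: SL2_eq; rewrite SL2_mulE ?z11 ?z12 ?z21 ?z22 -?D x11; ring.
by rewrite {1}xV !mulgA [(z * y)%g]zC -[(y * z * z)%g]mulgA zz mulg1.
Qed.

Lemma commutator_diag_lower l y : l != 0 -> e11 y = 0 ->
  let c := commutator (diag l) y in
  [/\ e11 c = l ^+ 2, e12 c = 0, e21 c = e21 y * e22 y * (l ^- 2 - 1) &
      e22 c = l ^- 2].
Proof.
move=> l0 y11; have := SL2_detE y; rewrite y11 mul0r add0r => D.
have y21 : e21 y != 0.
  by apply: contra_eq_neq D => ->; rewrite mulr0 oppr0 eq_sym oner_neq0.
have y12 : e12 y = - (e21 y)^-1.
  by apply: (mulIf y21); rewrite mulNr mulVf // -D opprK.
by split; rewrite /commutator !SL2E !diagE // y11 ?y12; field; rewrite ?l0 ?y21.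
Qed.

(** For lower triangular c the commutation of c with x c x^-1 is one equation in
    the (2,1) entry; it is y_21 y_22 (l - 1/l)^3 (l + 1/l) = 0, up to the sign
    and a power of l. *)
Lemma word_map_diag l y : l != 0 -> l - l^-1 != 0 -> l + l^-1 != 0 ->
  e11 y = 0 -> word_map (diag l) y = 1%g <-> e22 y = 0.
Proof.
move=> l0 lm lp y11; rewrite /word_map commutator_eq1.
have := commutator_diag_lower l0 y11; move: (commutator _ _) => c [c11 c12 c21 c22].
have y21 : e21 y != 0.
  have := SL2_detE y; rewrite y11 mul0r add0r; apply: contra_eq_neq => ->.
  by rewrite mulr0 oppr0 eq_sym oner_neq0.
split=> [/(congr1 (fun x => e21 x))|y22].
  rewrite !SL2E !diagE // ?c11 ?c12 ?c21 ?c22 => /eqP.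
  rewrite -subr_eq0 => /eqP E.
  have {}E : e21 y * (l - l^-1) * (l - l^-1) * (l - l^-1) * (l + l^-1) * e22 y = 0.
    by rewrite -[RHS](mulr0 (- l ^+ 2)) -[X in _ = _ * X]E; field.
  move/eqP: E; rewrite !mulf_eq0 (negbTE y21) (negbTE lm) (negbTE lp) /=.
  by move/eqP.
rewrite y22 mulr0 mul0r in c21.
by apply: SL2_eq; rewrite !SL2E !diagE // ?c11 ?c12 ?c21 ?c22; ring.
Qed.

End WordMap.

(** * Zariski closed conditions on pairs *)

Section PolynomialMaps.
Variable F : fieldType.
Implicit Types f : SL2xSL2 F -> F.

Definition polynomial_function f := exists P, forall p, f p = polyfun P p.

Lemma polynomial_function_cst a : polynomial_function (fun=> a).
Proof. by exists a%:MP => p; rewrite /polyfun mevalC. Qed.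

Lemma polynomial_functionD f f' : polynomial_function f ->
  polynomial_function f' -> polynomial_function (fun p => f p + f' p).
Proof.
by move=> [P fP] [P' fP']; exists (P + P') => p; rewrite fP fP' /polyfun mevalD.
Qed.

Lemma polynomial_functionN f : polynomial_function f ->
  polynomial_function (fun p => - f p).
Proof. by move=> [P fP]; exists (- P) => p; rewrite fP /polyfun mevalN. Qed.

Lemma polynomial_functionM f f' : polynomial_function f ->
  polynomial_function f' -> polynomial_function (fun p => f p * f' p).
Proof.
by move=> [P fP] [P' fP']; exists (P * P') => p; rewrite fP fP' /polyfun mevalM.
Qed.

Lemma closed_polynomial_function f a : polynomial_function f ->
  closed [set p : SL2xSL2 F | f p = a].
Proof.
move=> [P fP]; rewrite (_ : [set p | _] = [set p | polyfun (P - a%:MP) p = 0]).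
  exact: closed_polyfun.
apply/seteqP; split=> p /=; rewrite fP /polyfun mevalB mevalC.
  by move=> ->; rewrite subrr.
by move/eqP; rewrite subr_eq0 => /eqP.
Qed.

Definition polynomial_map (h : SL2xSL2 F -> SL2 F) :=
  SL2_valued polynomial_function h.

Lemma polynomial_map_fst : polynomial_map fst.
Proof.
move=> i j; exists 'X_(lshift _ (mxvec_index i j)) => p.
by rewrite /polyfun mevalXU /coords row_mxEl mxvecE.
Qed.

Lemma polynomial_map_snd : polynomial_map snd.
Proof.
move=> i j; exists 'X_(rshift _ (mxvec_index i j)) => p.
by rewrite /polyfun mevalXU /coords row_mxEr mxvecE.
Qed.

Lemma polynomial_ring : function_ring setT polynomial_function.
Proof.
split.
- exact: polynomial_function_cst.
- exact: polynomial_functionD.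
- exact: polynomial_functionM.
- exact: polynomial_functionN.
- by move=> f f' [P fP] ff'; exists P => p; rewrite ff'.
Qed.

Lemma polynomial_map_commutator h h' : polynomial_map h -> polynomial_map h' ->
  polynomial_map (fun p => commutator (h p) (h' p)).
Proof.
move=> Ph Ph'; have PV := SL2_valuedV polynomial_ring.
have PM := SL2_valuedM polynomial_ring.
exact: PM _ _ (PM _ _ (PM _ _ Ph Ph') (PV _ Ph)) (PV _ Ph').
Qed.

Lemma closed_fiber_SL2 h g : polynomial_map h -> closed [set p | h p = g].
Proof.
move=> Ph; rewrite (_ : [set p | _] = [set p | e11 (h p) = e11 g] `&`
  [set p | e12 (h p) = e12 g] `&` [set p | e21 (h p) = e21 g] `&`
  [set p | e22 (h p) = e22 g]).
  by do 3?apply: closedI; apply: closed_polynomial_function.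
apply/seteqP; split=> [p /= ->|p /= [[[? ?] ?] ?]] //.
exact: SL2_eq.
Qed.

Lemma closed_commutator_trace a :
  closed [set p : SL2xSL2 F | commutator_trace p.1 p.2 = a].
Proof.
apply: closed_polynomial_function; apply: (SL2_valued_tr polynomial_ring).
exact: polynomial_map_commutator polynomial_map_fst polynomial_map_snd.
Qed.

Lemma closed_trace_fst a : closed [set p : SL2xSL2 F | tr p.1 = a].
Proof.
apply: closed_polynomial_function.
exact: (SL2_valued_tr polynomial_ring polynomial_map_fst).
Qed.

Lemma closed_cubic_form : closed [set p : SL2xSL2 F | cubic_form p.1 p.2 = 0].
Proof.
have P1 := SL2_valued_tr polynomial_ring polynomial_map_fst.
have P2 := SL2_valued_tr polynomial_ring polynomial_map_snd.
have P12 := SL2_valued_tr polynomial_ring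
  (SL2_valuedM polynomial_ring polynomial_map_fst polynomial_map_snd).
apply: closed_polynomial_function; apply: polynomial_functionD; last first.
  by apply: polynomial_functionN; apply: polynomial_functionM.
apply: polynomial_functionD; last first.
  by apply: polynomial_functionN; apply: polynomial_functionM.
by do 2?apply: polynomial_functionM.
Qed.

End PolynomialMaps.

(** * Decomposition of the two varieties *)

Section Components.
Variable F : numClosedFieldType.
Implicit Types (x y g dw : SL2 F).

Lemma closed_word_map : closed [set p : SL2xSL2 F | word_map p.1 p.2 = 1%g].
Proof.
have Pc := polynomial_map_commutator (@polynomial_map_fst F) (@polynomial_map_snd F).
apply/closed_fiber_SL2/(polynomial_map_commutator Pc).
exact: (SL2_valued_conj (polynomial_ring F)) (@polynomial_map_fst F) Pc.
Qed.

(** The matrices with vanishing (1,1) entry form the coset of the Borel subgroup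
    by any antidiagonal matrix. *)
Definition antiborel_saturation : set (SL2xSL2 F) :=
  conj_saturation (@torus F) [set y | e11 y = 0].
Definition antitorus_saturation : set (SL2xSL2 F) := conj_saturation (@torus F) (@antitorus F).

Lemma antitorus_saturation_sub : antitorus_saturation `<=` antiborel_saturation.
Proof.
move=> p /conj_saturationP [g [x [y [Tx [y11 _] ->]]]].
by apply/conj_saturationP; exists g, x, y.
Qed.

Lemma antiborel_saturation_cubic_form :
  antiborel_saturation `<=` [set p | cubic_form p.1 p.2 = 0].
Proof.
move=> p /conj_saturationP [g [x [y [+ y11 ->]]]] /=.
rewrite torus_diag => -[l l0 <-].
by rewrite cubic_form_conj cubic_form_diag // y11 mul0r mulr0.
Qed.

Lemma antitorus_saturation_word_map :
  antitorus_saturation `<=` [set p | word_map p.1 p.2 = 1%g].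
Proof.
move=> p /conj_saturationP [g [x [y [+ [y11 y22] ->]]]] /=.
rewrite torus_diag => -[l l0 <-].
have [c11 c12 c21 c22] := commutator_diag_lower l0 y11.
rewrite word_map_conj (_ : word_map _ _ = 1%g) ?mulg1 ?mulgV //.
apply/commutator_eq1; rewrite y22 mulr0 mul0r in c21.
move: (commutator _ _) c11 c12 c21 c22 => c c11 c12 c21 c22.
by apply: SL2_eq; rewrite !SL2E !diagE // ?c11 ?c12 ?c21 ?c22; ring.
Qed.

(** In the diagonalizable case the form is a multiple of y_11 y_22, and an
    antidiagonal conjugation exchanges the two entries. In the parabolic case the
    form is the opposite of commutator_trace x y - 2. *)
Lemma cubic_form_eq0_conj x y :
  commutator_trace x y <> 2 -> cubic_form x y = 0 ->
  exists g l y', [/\ l != 0, l - l^-1 != 0, e11 y' = 0,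
    x = (g * diag l * g^-1)%g & y = (g * y' * g^-1)%g].
Proof.
case: (conj_normal_form x) => [[g [l [l0 ll ->]]]|[g [a [b [a2 ->]]]]];
  have [y' ->] := conj_exists g y;
  rewrite commutator_trace_conj cubic_form_conj; last first.
  rewrite commutator_trace_parabolic // cubic_form_parabolic // => k2 /eqP.
  by rewrite oppr_eq0 => /eqP E; case: k2; rewrite E addr0.
move=> _; rewrite cubic_form_diag // => /eqP.
rewrite !mulf_eq0 (negbTE ll) /= => /orP[]/eqP y0; first by exists g, l, y'.
exists (g * (antidiag 1)^-1)%g, l^-1, (antidiag 1 * y' * (antidiag 1)^-1)%g.
split; rewrite ?invr_eq0 //.
- by rewrite invrK -opprB oppr_eq0.
- by rewrite !SL2E !(antidiagE (oner_neq0 _)) y0; ring.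
- by rewrite -antidiag_diagJ // !invgM !invgK !mulgA !mulgVK.
- by rewrite !invgM !invgK !mulgA !mulgVK.
Qed.

Lemma trace_word_map_eq2 x y : tr (word_map x y) = 2 <->
  [\/ commutator_trace x y = 2, cubic_form x y = 0 | tr x = 0].
Proof.
have E := word_map_trace x y; split=> [w2|].
  move: E; rewrite w2 subrr => /esym/eqP; rewrite !mulf_eq0 !orbb subr_eq0.
  by move=> /orP[/orP[]|] /eqP; [apply: Or33|apply: Or31|apply: Or32].
move=> H; apply/eqP; rewrite -subr_eq0 E; apply/eqP.
by case: H => ->; rewrite ?subrr ?expr0n ?mulr0 ?mul0r.
Qed.

Lemma trace_word_map_decomposition :
  [set p : SL2xSL2 F | tr (word_map p.1 p.2) = 2] =
  [set p | commutator_trace p.1 p.2 = 2] `|` closure antiborel_saturation `|`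
  [set p | tr p.1 = 0].
Proof.
apply/seteqP; split=> [[x y] /trace_word_map_eq2 /= H|p].
  have [k2|k2] := pselect (commutator_trace x y = 2); first by left; left.
  case: H => [//|c0|s0]; last by right.
  left; right; apply: subset_closure.
  have [g [l [y' [l0 _ y11 -> ->]]]] := cubic_form_eq0_conj k2 c0.
  apply/conj_saturationP; exists g, (diag l), y'; split=> //.
  by apply/torusP; rewrite !diagE.
move=> H; apply/trace_word_map_eq2; case: H => [[|]|].
- by move=> ?; apply: Or31.
- move/(closure_sub (@closed_cubic_form F) antiborel_saturation_cubic_form) => ?.
  exact: Or32.
- by move=> ?; apply: Or33.
Qed.

Lemma word_map_decomposition :
  [set p : SL2xSL2 F | word_map p.1 p.2 = 1%g] =
  [set p | commutator_trace p.1 p.2 = 2] `|` closure antitorus_saturation `|`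
  [set p | tr p.1 = 0].
Proof.
apply/seteqP; split=> [[x y] /= w1|p].
  have [k2|k2] := pselect (commutator_trace x y = 2); first by left; left.
  have [s0|s0] := pselect (tr x = 0); first by right.
  have c0 : cubic_form x y = 0.
    have /trace_word_map_eq2 [//|//|//] : tr (word_map x y) = 2.
    by rewrite w1 SL2_trE !SL2E.
  left; right; apply: subset_closure.
  have [g [l [y' [l0 ll y11 xE yE]]]] := cubic_form_eq0_conj k2 c0.
  move: w1 s0; rewrite xE yE word_map_conj SL2_trJ SL2_trE !diagE // => w1 /eqP lp.
  have /(word_map_diag l0 ll lp y11) y22 : word_map (diag l) y' = 1%g.
    by apply: (mulgI g); apply: (mulIg g^-1%g); rewrite w1 mulg1 mulgV.
  apply/conj_saturationP; exists g, (diag l), y'; split=> //.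
  by apply/torusP; rewrite !diagE.
case=> [[|]|].
- exact: commutator_trace2_word_map.
- exact: (closure_sub closed_word_map antitorus_saturation_word_map).
- exact: trace0_word_map.
Qed.

End Components.

(** * Four parameters for the saturation of the torus and its coset *)

Section Parametrization.
Variable F : numClosedFieldType.
Implicit Types (x y g : SL2 F) (a b l : F).

Lemma antitorus_antidiag1 : antitorus (antidiag 1 : SL2 F).
Proof. by split; rewrite antidiagE ?oner_neq0. Qed.

Lemma antitorus_antidiag : @antitorus F = [set antidiag b | b in [set b | b != 0]].
Proof.
apply/seteqP; split=> [y [y11 y22]|_ [b b0 <-]]; last by split; rewrite antidiagE.
have D : e12 y * - e21 y = 1 by rewrite -(SL2_detE y) y11 y22; ring.
have y12 : e12 y != 0 by apply: contra_eq_neq D => ->; rewrite mul0r eq_sym oner_neq0.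
exists (e12 y) => //; apply: SL2_eq; rewrite !antidiagE // ?y11 ?y22 //.
by apply: (mulfI y12); rewrite mulrN mulfV // -D mulrN opprK.
Qed.

Lemma torus_conj_torus m x : torus m -> torus x -> torus (m * x * m^-1)%g.
Proof.
move=> /torusP [m12 m21] /torusP [x12 x21]; apply/torusP.
by rewrite !SL2E m12 m21 x12 x21; split; ring.
Qed.

Lemma torus_conj_antitorus m y : torus m -> antitorus y -> antitorus (m * y * m^-1)%g.
Proof.
move=> /torusP [m12 m21] [y11 y22]; split; rewrite !SL2E m12 m21 y11 y22; ring.
Qed.

Lemma antitorus_conj_torus m x : antitorus m -> torus x -> torus (m * x * m^-1)%g.
Proof.
move=> [m12 m21] /torusP [x12 x21]; apply/torusP.
by rewrite !SL2E m12 m21 x12 x21; split; ring.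
Qed.

Lemma antitorus_conj_antitorus m y :
  antitorus m -> antitorus y -> antitorus (m * y * m^-1)%g.
Proof.
move=> [m12 m21] [y11 y22]; split; rewrite !SL2E m12 m21 y11 y22; ring.
Qed.

(** Triangular factorization of a matrix with nonzero (1,1) entry. *)
Lemma big_cell g : e11 g != 0 ->
  g = (lower (e21 g / e11 g) * upper (e12 g * e11 g) * diag (e11 g))%g.
Proof.
move=> g11; have g22 : e22 g = (1 + e12 g * e21 g) / e11 g.
  by rewrite -(SL2_detE g); field.
by apply: SL2_eq; rewrite !SL2E !lowerE !upperE !diagE // ?g22; field.
Qed.

Definition big_cell_conj a b x : SL2 F :=
  (lower a * upper b * x * (lower a * upper b)^-1)%g.

(** Right multiplication of g by a diagonal or an antidiagonal matrix preserves the
    torus and its coset, so g may be taken in the big cell and its diagonal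
    factor dropped. *)
Lemma antitorus_saturation_parametrization p : antitorus_saturation p -> exists a b l c,
  [/\ l != 0, c != 0 &
   p = (big_cell_conj a b (diag l), big_cell_conj a b (antidiag c))].
Proof.
move=> /conj_saturationP [g [x [y [Tx Ay ->]]]].
wlog g11 : g x y Tx Ay / e11 g != 0.
  move=> H; have [g11|] := eqVneq (e11 g) 0; last exact: H.
  have Aw := antitorus_antidiag1.
  have := H (g * (antidiag 1)^-1)%g (antidiag 1 * x * (antidiag 1)^-1)%g
    (antidiag 1 * y * (antidiag 1)^-1)%g (antitorus_conj_torus Aw Tx)
    (antitorus_conj_antitorus Aw Ay).
  rewrite !invgM !invgK !mulgA !mulgVK; apply.
  rewrite !SL2E !(antidiagE (oner_neq0 _)) g11 mul0r add0r opprK invr1 mulr1.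
  have := SL2_detE g; rewrite g11 mul0r add0r; apply: contra_eq_neq => ->.
  by rewrite mul0r oppr0 eq_sym oner_neq0.
have Tm : torus (diag (e11 g)) by apply/torusP; rewrite !diagE.
have := torus_conj_torus Tm Tx; rewrite {1}torus_diag => -[l l0 lE].
have := torus_conj_antitorus Tm Ay; rewrite {1}antitorus_antidiag => -[c c0 cE].
exists (e21 g / e11 g), (e12 g * e11 g), l, c; split=> //.
rewrite /big_cell_conj lE cE {1 2 3 4}(big_cell g11).
by rewrite !invgM !mulgA.
Qed.

(** The parameters a, b of the big cell, l of the torus and c of its coset are the
    four coordinates; h inverts l and c. *)
Lemma antitorus_saturation_chain_bound m :
  has_irreducible_chain (closure (@antitorus_saturation F)) m -> (m <= 4)%N.
Proof.
pose i0 : 'I_4 := inord 0; pose i1 : 'I_4 := inord 1.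
pose i2 : 'I_4 := inord 2; pose i3 : 'I_4 := inord 3.
pose h : {mpoly F[4]} := 'X_i2 * 'X_i3.
have hE v : h.@[v] = v i2 * v i3 by rewrite mevalM !mevalXU.
have lX i : localized h (fun v => v i).
  by exists 0%N, 'X_i => v _; rewrite expr0 mul1r mevalXU.
have h2 v : h.@[v] != 0 -> v i2 != 0.
  by rewrite hE mulf_eq0 negb_or => /andP[].
have h3 v : h.@[v] != 0 -> v i3 != 0.
  by rewrite hE mulf_eq0 negb_or => /andP[].
have lV2 : localized h (fun v => (v i2)^-1).
  by exists 1%N, 'X_i3 => v /h2 v2; rewrite expr1 hE mevalXU mulrC mulKf.
have lV3 : localized h (fun v => (v i3)^-1).
  by exists 1%N, 'X_i2 => v /h3 v3; rewrite expr1 hE mevalXU mulfK.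
have ringL := localized_ring h.
pose g (v : 'I_4 -> F) := (lower (v i0) * upper (v i1))%g.
have lg : SL2_valued (localized h) g.
  exact: SL2_valuedM ringL _ _ (SL2_valued_lower ringL (lX i0))
                               (SL2_valued_upper ringL (lX i1)).
pose E (v : 'I_4 -> F) : SL2xSL2 F :=
  (g v * diag (v i2) * (g v)^-1, g v * antidiag (v i3) * (g v)^-1)%g.
apply: (@parametrized_chain_bound F (closure (@antitorus_saturation F))
  (@antitorus_saturation F) 4 h E m) => [//|i|z].
  apply: (function_ring_coords ringL); apply: (SL2_valued_conj ringL) => //.
    exact: (SL2_valued_diag ringL).
  exact: (SL2_valued_antidiag ringL).
move=> /antitorus_saturation_parametrization [a [b [l [c [l0 c0 ->]]]]].
have [v [v0 v1 v2 v3]] : exists v : 'I_4 -> F, [/\ v i0 = a, v i1 = b, v i2 = l & v i3 = c].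
  by exists (fun i => [:: a; b; l; c]`_i); rewrite /i0 /i1 /i2 /i3 !inordK.
exists v; first by rewrite hE v2 v3 mulf_neq0.
by rewrite /E /g v0 v1 v2 v3.
Qed.

End Parametrization.

(** * Traceless pairs as orbits of the quaternion pair *)

Section Chain.
Variable F : numClosedFieldType.
Implicit Types (x y g : SL2 F) (p : SL2xSL2 F).

Definition quaternion_i : SL2 F := diag 'i.
Definition quaternion_j : SL2 F := antidiag 1.

(** The pair generates the quaternion group of order 8, whose centralizer is the
    centre: orbits of subgroups have the dimension of the subgroup. *)
Definition quaternion_orbit (K : set (SL2 F)) : set (SL2xSL2 F) :=
  conj_orbit K [set quaternion_i] [set quaternion_j].

Lemma quaternion_orbitP K p : quaternion_orbit K p <-> exists2 g, K g &
  p = (g * quaternion_i * g^-1, g * quaternion_j * g^-1)%g.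
Proof.
split=> [/conj_orbitP [g [_ [_ [Kg -> -> ->]]]]|[g Kg ->]]; first by exists g.
by apply/conj_orbitP; exists g, quaternion_i, quaternion_j.
Qed.

Definition traceless : set (SL2xSL2 F) :=
  [set p | tr p.1 = 0] `&` [set p | tr p.2 = 0] `&` [set p | tr (p.1 * p.2)%g = 0].

Definition traceless_flag : set (SL2xSL2 F) :=
  traceless `&` [set p | e21 p.1 = 0] `&` [set p | e11 p.1 = 'i].

Definition traceless_unipotent : set (SL2xSL2 F) :=
  traceless_flag `&` [set p | e21 p.2 = -1].

Definition traceless_point : set (SL2xSL2 F) :=
  traceless_unipotent `&` [set p | e12 p.1 = 0].

Lemma i_neq0 : 'i != 0 :> F. Proof. exact: neq0Ci. Qed.

Lemma quaternion_iE : (e11 quaternion_i = 'i) * (e12 quaternion_i = 0) *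
  (e21 quaternion_i = 0) * (e22 quaternion_i = - 'i).
Proof. by rewrite !diagE ?i_neq0 // invCi. Qed.

Lemma quaternion_jE : (e11 quaternion_j = 0) * (e12 quaternion_j = 1) *
  (e21 quaternion_j = -1) * (e22 quaternion_j = 0).
Proof. by rewrite !antidiagE ?oner_neq0 // invr1. Qed.

Lemma tracelessP x y :
  traceless (x, y) <-> [/\ tr x = 0, tr y = 0 & tr (x * y)%g = 0].
Proof. by split=> [[[]]|[]]. Qed.

Lemma traceless_flagP x y : traceless_flag (x, y) <->
  [/\ traceless (x, y), e21 x = 0 & e11 x = 'i].
Proof. by split=> [[[]]|[]]. Qed.

Lemma traceless_unipotentP x y : traceless_unipotent (x, y) <->
  traceless_flag (x, y) /\ e21 y = -1.
Proof. by []. Qed.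

Lemma traceless_pointP x y : traceless_point (x, y) <->
  traceless_unipotent (x, y) /\ e12 x = 0.
Proof. by []. Qed.

Lemma traceless_conj g x y :
  traceless (g * x * g^-1, g * y * g^-1)%g <-> traceless (x, y).
Proof. by rewrite !tracelessP conj_mul !SL2_trJ. Qed.

Lemma quaternion_traceless : traceless (quaternion_i, quaternion_j).
Proof.
apply/tracelessP; rewrite !SL2_trE !SL2E.
by rewrite !quaternion_iE !quaternion_jE; split; ring.
Qed.

Lemma quaternion_orbit_conj (K K' : set (SL2 F)) g x y :
  (forall k, K k -> K' (g * k)%g) -> quaternion_orbit K (x, y) ->
  quaternion_orbit K' (g * x * g^-1, g * y * g^-1)%g.
Proof.
move=> gK /quaternion_orbitP [k Kk [-> ->]]; apply/quaternion_orbitP.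
by exists (g * k)%g; [exact: gK|rewrite !invgM !mulgA].
Qed.

Lemma traceless_flag_e22 x y : traceless_flag (x, y) -> e22 x = - 'i.
Proof.
move=> [[/tracelessP [+ _ _] _] /= x11]; rewrite SL2_trE x11 addrC => /eqP.
by rewrite addr_eq0 => /eqP.
Qed.

(** The conditions tr y = tr xy = 0 are linear in y. *)
Lemma traceless_flag_antitorus x y : traceless_flag (x, y) -> 
  e22 y = - e11 y /\ 2 * 'i * e11 y + e12 x * e21 y = 0.
Proof.
move=> H; have x22 := traceless_flag_e22 H; case: H => -[/tracelessP [_]].
rewrite !SL2_trE !SL2E => y0 + /= x21 x11; rewrite x21 x11 x22.
have y22 : e22 y = - e11 y by apply/eqP; rewrite -addr_eq0 addrC y0.
by rewrite y22 => E; split=> //; rewrite -[RHS]E; ring.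
Qed.

Lemma traceless_pointE : traceless_point = quaternion_orbit [set 1%g].
Proof.
apply/seteqP; split=> [[x y]|p /quaternion_orbitP [_ -> ->]]; last first.
  rewrite !mul1g invg1 !mulg1; do !split; rewrite /= ?quaternion_iE ?quaternion_jE //;
  by case: quaternion_traceless => -[].
case=> -[H /= y21] /= x12; have [y22] := traceless_flag_antitorus H.
have x22 := traceless_flag_e22 H; case: H => -[_ /= x21] /= x11.
rewrite x12 mul0r addr0 => /eqP.
rewrite !mulf_eq0 (negbTE i_neq0) pnatr_eq0 /= => /eqP y11.
rewrite y11 oppr0 in y22; have := SL2_detE y.
rewrite y11 y21 mul0r add0r mulrN1 opprK => y12.
apply/quaternion_orbitP; exists 1%g => //; rewrite !mul1g invg1 !mulg1.
by congr (_, _); apply: SL2_eq; rewrite ?quaternion_iE ?quaternion_jE.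
Qed.

(** A unipotent conjugation makes x diagonal, without changing the (2,1) entry of
    y. *)
Lemma traceless_unipotentE : traceless_unipotent = quaternion_orbit (range (@upper F)).
Proof.
apply/seteqP; split=> [[x y] H|p /quaternion_orbitP [_ [a _ <-] ->]]; last first.
  apply/traceless_unipotentP; split; first (apply/traceless_flagP; split).
  - exact/traceless_conj/quaternion_traceless.
  - by rewrite !SL2E !upperE !quaternion_iE; ring.
  - by rewrite !SL2E !upperE !quaternion_iE; ring.
  - by rewrite !SL2E !upperE !quaternion_jE; ring.
have x22 := traceless_flag_e22 H.1.
case: H => -[[tl /= x21] /= x11] /= y21.
pose u : SL2 F := upper (e12 x * ('i / 2)).
rewrite (conj_by u x) (conj_by u y).
apply: (@quaternion_orbit_conj [set 1%g]) => [_ ->|].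
  by rewrite mulg1; eexists.
rewrite -traceless_pointE; apply/traceless_pointP; split.
  apply/traceless_unipotentP; split; first (apply/traceless_flagP; split).
- by apply/(traceless_conj u); rewrite -!conj_by.
- by rewrite !SL2E !upperE x21; ring.
- by rewrite !SL2E !upperE x11 x21; ring.
- by rewrite !SL2E !upperE y21; ring.
- rewrite !SL2E !upperE x11 x22 x21.
  transitivity (e12 x * (1 + 'i ^+ 2)); first by field.
  by rewrite sqrCi subrr mulr0.
Qed.

(** The (2,1) entry of y cannot vanish, since y would then be zero on the diagonal
    as well; conjugation by diag(m, 1/m) multiplies it by a square, which can be
    any nonzero number. *)
Lemma traceless_flagE : traceless_flag = quaternion_orbit (@borel F).
Proof.
apply/seteqP; split=> [[x y] H|p /quaternion_orbitP [b Bb ->]]; last first.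
  have b21 := (borelP b).1 Bb; have b11 := borel_e11_neq0 Bb.
  have b22 := e22_inv (or_intror b21).
  apply/traceless_flagP; split.
  - exact/traceless_conj/quaternion_traceless.
  - by rewrite !SL2E b21 !quaternion_iE; ring.
  - by rewrite !SL2E b21 b22 !quaternion_iE; field.
have [y22 yx] := traceless_flag_antitorus H.
case: H => -[tl /= x21] /= x11.
have y21 : e21 y != 0.
  apply/eqP => y21; move/eqP: yx; rewrite y21 mulr0 addr0 !mulf_eq0.
  rewrite (negbTE i_neq0) pnatr_eq0 /= => /eqP y11; have := SL2_detE y.
  by rewrite y11 y21 mul0r mulr0 subrr => /eqP; rewrite eq_sym oner_eq0.
pose m := sqrtC (- (e21 y)^-1).
have m2 : m ^+ 2 = - (e21 y)^-1 by apply: sqrtCK.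
have m0 : m != 0 by rewrite sqrtC_eq0 oppr_eq0 invr_eq0.
rewrite (conj_by (diag m) x) (conj_by (diag m) y).
apply: (@quaternion_orbit_conj (range (@upper F))) => [_ [a _ <-]|].
  by apply/borelP; rewrite !SL2E !upperE !diagE //; ring.
rewrite -traceless_unipotentE; apply/traceless_unipotentP; split.
  apply/traceless_flagP; split.
- by apply/(traceless_conj (diag m)); rewrite -!conj_by.
- by rewrite !SL2E !diagE // x21; ring.
- by rewrite !SL2E !diagE // x11 x21; field.
- rewrite !SL2E !diagE //; transitivity (m ^+ 2 * e21 y); first by ring.
  by rewrite m2 mulNr mulVf.
Qed.

(** Matrices of trace 0 form one conjugacy class, so x may be taken diagonal. *)
Lemma tracelessE : traceless = quaternion_orbit setT.
Proof.
apply/seteqP; split=> [[x y] H|p /quaternion_orbitP [g _ ->]]; last first.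
  exact/traceless_conj/quaternion_traceless.
have [i0 _ _] := (tracelessP _ _).1 quaternion_traceless.
have [x0 _ _] := (tracelessP _ _).1 H.
have [g xE] := trace0_conj i0 x0.
rewrite (conj_by g x) (conj_by g y).
apply: (@quaternion_orbit_conj (@borel F)) => //.
have gx : (g^-1 * x * g = quaternion_i)%g by rewrite xE !mulgA mulVg mul1g mulgVK.
rewrite -traceless_flagE; apply/traceless_flagP; split.
- by apply/(traceless_conj g); rewrite -!conj_by.
- by rewrite gx quaternion_iE.
- by rewrite gx quaternion_iE.
Qed.

End Chain.

(** * The dimension is four *)

Section Dimension.
Variable F : numClosedFieldType.
Implicit Types (x y g dw : SL2 F) (p : SL2xSL2 F).

Lemma antitorus_saturation_irreducible : irreducible_set (@antitorus_saturation F).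
Proof.
rewrite /antitorus_saturation -(left_translate_torus (antitorus_antidiag1 F)).
apply: conj_orbit_irreducible; first exact: rationally_connected_SL2.
  exact: rationally_connected_torus.
exact/rationally_connected_left_translate/rationally_connected_torus.
Qed.

Lemma traceless_sub_antitorus_saturation : @traceless F `<=` @antitorus_saturation F.
Proof.
rewrite tracelessE => p /quaternion_orbitP [g _ ->].
apply/conj_saturationP; exists g, (quaternion_i F), (quaternion_j F); split=> //.
  by apply/torusP; rewrite !quaternion_iE.
by split; rewrite quaternion_jE.
Qed.

Lemma quaternion_orbit_irreducible K : rationally_connected K ->
  irreducible_set (@quaternion_orbit F K).
Proof.
by move=> rcK; apply: conj_orbit_irreducible => //; apply: rationally_connected_set1.
Qed.

Lemma closed_traceless : closed (@traceless F).
Proof.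
have trC := SL2_valued_tr (polynomial_ring F).
apply: closedI; first apply: closedI; apply: closed_polynomial_function.
- exact: (trC _ (@polynomial_map_fst F)).
- exact: (trC _ (@polynomial_map_snd F)).
- exact: (trC _ (SL2_valuedM (polynomial_ring F)
                   (@polynomial_map_fst F) (@polynomial_map_snd F))).
Qed.

Lemma closed_traceless_flag : closed (@traceless_flag F).
Proof.
apply: closedI; first apply: closedI.
- exact: closed_traceless.
- exact: closed_polynomial_function (@polynomial_map_fst F 1 0).
- exact: closed_polynomial_function (@polynomial_map_fst F 0 0).
Qed.

Lemma closed_traceless_unipotent : closed (@traceless_unipotent F).
Proof.
apply: closedI; first exact: closed_traceless_flag.
exact: closed_polynomial_function (@polynomial_map_snd F 1 0).
Qed.

Lemma closed_traceless_point : closed (@traceless_point F).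
Proof.
apply: closedI; first exact: closed_traceless_unipotent.
exact: closed_polynomial_function (@polynomial_map_fst F 0 1).
Qed.

Lemma diag2_antidiag_antitorus_saturation dw : antitorus dw ->
  @antitorus_saturation F (diag 2, dw).
Proof.
move=> Adw; apply/conj_saturationP; exists 1%g, (diag 2), dw.
rewrite !mul1g invg1 !mulg1; split=> //.
by apply/torusP; rewrite !diagE // pnatr_eq0.
Qed.

Lemma tr_diag2_neq0 : tr (diag 2 : SL2 F) != 0.
Proof.
rewrite SL2_trE !diagE ?two_neq0 // lt0r_neq0 // addr_gt0 ?invr_gt0 ?ltr0n //.
Qed.

(** The orbits of 1, of the unipotent group, of the Borel subgroup and of SL2, and
    finally the whole closure, which contains a pair with tr x <> 0. *)
Lemma traceless_chain : has_irreducible_chain (closure (@antitorus_saturation F)) 4.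
Proof.
pose Z k := match k with
  | 0 => @traceless_point F | 1 => @traceless_unipotent F
  | 2 => @traceless_flag F | 3 => @traceless F | _ => closure (@antitorus_saturation F) end.
have A1 := antitorus_antidiag1 F.
exists Z; split.
  have tl_rel (C : set (SL2xSL2 F)) : closed C -> C `<=` @traceless F ->
      exists2 C', closed C' & C = closure (@antitorus_saturation F) `&` C'.
    move=> cC Ctl; exists C => //; apply/esym/setIidr => p /Ctl.
    move/traceless_sub_antitorus_saturation.
    exact: subset_closure.
  case=> [|[|[|[|[|//]]]]] _; split => /=.
  - rewrite traceless_pointE; apply: quaternion_orbit_irreducible.
    exact: rationally_connected_set1.
  - by apply: tl_rel; [exact: closed_traceless_point|move=> p [[[[]]]]].
  - rewrite traceless_unipotentE; apply: quaternion_orbit_irreducible.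
    exact: rationally_connected_upper.
  - by apply: tl_rel; [exact: closed_traceless_unipotent|move=> p [[[]]]].
  - rewrite traceless_flagE; apply: quaternion_orbit_irreducible.
    exact: rationally_connected_borel.
  - by apply: tl_rel; [exact: closed_traceless_flag|move=> p [[]]].
  - rewrite tracelessE; apply: quaternion_orbit_irreducible.
    exact: rationally_connected_SL2.
  - by apply: tl_rel; [exact: closed_traceless|].
  - exact/irreducible_closure/antitorus_saturation_irreducible.
  - by exists setT; [exact: closedT|rewrite setIT].
have ii : 'i != - 'i :> F.
  by rewrite -subr_eq0 opprK -mulr2n mulrn_eq0 /= neq0Ci.
have orbit_mem (K : set (SL2 F)) g : K g -> quaternion_orbit K
    (g * quaternion_i F * g^-1, g * quaternion_j F * g^-1)%g.
  by move=> Kg; apply/quaternion_orbitP; exists g.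
case=> [|[|[|[|//]]]] _; rewrite /Z; split.
- by move=> p [].
- rewrite traceless_unipotentE => /(_ _ (orbit_mem _ (upper 1) (imageT _ _))).
  move=> /traceless_pointP [_]; rewrite !SL2E !upperE !quaternion_iE => E.
  move/eqP: ii; apply; apply/eqP; rewrite -subr_eq0 -oppr_eq0 -[X in _ == X]E.
  by apply/eqP; ring.
- by move=> p [].
- rewrite traceless_flagE => H.
  have /H : quaternion_orbit (@borel F) (diag 2 * quaternion_i F * (diag 2)^-1,
      diag 2 * quaternion_j F * (diag 2)^-1)%g.
    by apply/orbit_mem/borelP; rewrite diagE ?two_neq0.
  move=> /traceless_unipotentP [_]; rewrite !SL2E !(diagE (two_neq0 F)) !quaternion_jE => E.
  move/eqP: (diag2_sub_neq0 F); apply; apply: (mulfI (two_neq0 F)).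
  have E' : 2^-1 * 2^-1 = 1 :> F by apply: oppr_inj; rewrite -E; ring.
  have : 2 * 2 * (2^-1 * 2^-1) = 1 :> F by field.
  by rewrite E' mulr1 => /eqP; rewrite -natrM pnatr_eq1.
- by move=> p [[]].
- rewrite tracelessE => /(_ _ (orbit_mem _ (antidiag 1) I)).
  move=> /traceless_flagP [_ _].
  rewrite !SL2E !(antidiagE (oner_neq0 _)) !quaternion_iE => E.
  by move/eqP: ii; apply; rewrite -[LHS]E; field.
- by move=> p /traceless_sub_antitorus_saturation; apply: subset_closure.
- move=> /(_ _ (subset_closure (diag2_antidiag_antitorus_saturation A1))) /tracelessP [/eqP].
  by rewrite (negbTE tr_diag2_neq0).
Qed.

Lemma antitorus_saturation_krull_dim : has_krull_dim (closure (@antitorus_saturation F)) 4.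
Proof.
by split; [exact: traceless_chain|move=> m; exact: antitorus_saturation_chain_bound].
Qed.

End Dimension.

(** * Irreducible components *)

Section MainResult.
Variable F : numClosedFieldType.
Implicit Types (x y g dw : SL2 F).

Lemma commutator_trace2_irreducible :
  irreducible_set [set p : SL2xSL2 F | commutator_trace p.1 p.2 = 2].
Proof.
rewrite commutator_trace_sat_borel; apply: conj_orbit_irreducible.
- exact: rationally_connected_SL2.
- exact: rationally_connected_borel.
- exact: rationally_connected_borel.
Qed.

(** The matrices of trace 0 form one conjugacy class and SL2 is stable under
    conjugation, so this is the saturation of a point times SL2. *)
Lemma trace0_irreducible : irreducible_set [set p : SL2xSL2 F | tr p.1 = 0].
Proof.
have j0 : tr (antidiag 1 : SL2 F) = 0.
  by rewrite SL2_trE !(antidiagE (oner_neq0 _)) addr0.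
rewrite (_ : [set p | _] = conj_saturation [set antidiag 1] setT).
  apply: conj_orbit_irreducible; first exact: rationally_connected_SL2.
    exact: rationally_connected_set1.
  exact: rationally_connected_SL2.
apply/seteqP; split=> [[x y] /= x0|p /conj_saturationP [g [_ [y [-> _ ->]]]]] /=.
  have [g ->] := trace0_conj j0 x0; have [y' ->] := conj_exists g y.
  by apply/conj_saturationP; exists g, (antidiag 1), y'.
by rewrite -[LHS]/(tr (g * antidiag 1 * g^-1)%g) SL2_trJ.
Qed.

Lemma antiborel_saturation_irreducible : irreducible_set (@antiborel_saturation F).
Proof.
rewrite /antiborel_saturation -(left_translate_borel (antitorus_antidiag1 F)).
apply: conj_orbit_irreducible; first exact: rationally_connected_SL2.
  exact: rationally_connected_torus.
exact/rationally_connected_left_translate/rationally_connected_borel.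
Qed.

Lemma commutator_trace_diag2_1 : commutator_trace (diag 2) 1%g = 2 :> F.
Proof. by rewrite commutator_trace_diag ?two_neq0 // !SL2_oneE !mulr0 subr0. Qed.

Lemma cubic_form_diag2_1 : cubic_form (diag 2) 1%g != 0 :> F.
Proof.
rewrite cubic_form_diag ?two_neq0 // !SL2_oneE !mulr1.
by rewrite expf_neq0 // diag2_sub_neq0.
Qed.

Lemma commutator_trace_diag2_antitorus y : antitorus y ->
  commutator_trace (diag 2) y <> 2 :> F.
Proof.
move=> [y11 y22]; have := SL2_detE y; rewrite y11 y22 mul0r sub0r => D.
rewrite commutator_trace_diag ?two_neq0 // -[e12 y * e21 y]opprK D mulrN1 opprK.
rewrite -[X in _ <> X]addr0 => /addrI /eqP.
by rewrite expf_eq0 /= (negbTE (diag2_sub_neq0 F)).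
Qed.

Lemma cubic_form_antitorus_diag2 y : antitorus y -> cubic_form y (diag 2) != 0 :> F.
Proof.
move=> [y11 y22]; rewrite /cubic_form (_ : tr y = 0); last first.
  by rewrite SL2_trE y11 y22 addr0.
rewrite (_ : tr (y * diag 2)%g = 0); last first.
  by rewrite SL2_trE !SL2E !(diagE (two_neq0 F)) y11 y22; ring.
by rewrite !mul0r expr0n subr0 sub0r oppr_eq0 expf_neq0 // tr_diag2_neq0.
Qed.

Lemma commutator_trace_antitorus_diag2 y : antitorus y ->
  commutator_trace y (diag 2) <> 2 :> F.
Proof.
by move=> Ay; rewrite commutator_traceC; apply: commutator_trace_diag2_antitorus.
Qed.

(** The pairs (diag 2, 1), (diag 2, j) and (j, diag 2), with j antidiagonal, each
    lie in exactly one of the three sets. *)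
Lemma trace_components :
  let T0 := [set p : SL2xSL2 F | commutator_trace p.1 p.2 = 2] in
  let T1 := closure (@antiborel_saturation F) in
  let T2 := [set p : SL2xSL2 F | tr p.1 = 0] in
  irreducible_components [set p : SL2xSL2 F | tr (word_map p.1 p.2) = 2] = [set T0; T1; T2] /\
  [/\ T0 <> T1, T0 <> T2 & T1 <> T2].
Proof.
have Aj := antitorus_antidiag1 F; rewrite trace_word_map_decomposition.
have cubic := closure_sub (@closed_cubic_form F) (@antiborel_saturation_cubic_form F).
apply: irreducible_components3.
- exact: commutator_trace2_irreducible.
- exact/irreducible_closure/antiborel_saturation_irreducible.
- exact: trace0_irreducible.
- exact: closed_commutator_trace.
- exact: closed_closure.
- exact: closed_trace_fst.
- case/(_ (diag 2, 1%g) commutator_trace_diag2_1) => [/cubic|] /eqP.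
    exact/negP/cubic_form_diag2_1.
  exact/negP/tr_diag2_neq0.
- have mem := antitorus_saturation_sub (diag2_antidiag_antitorus_saturation Aj).
  case/(_ _ (subset_closure mem)) => [|/eqP]; first exact: commutator_trace_diag2_antitorus.
  exact/negP/tr_diag2_neq0.
- case/(_ (antidiag 1, diag 2) (antitorus_tr Aj)) => [|/cubic/eqP].
    exact: commutator_trace_antitorus_diag2.
  exact/negP/cubic_form_antitorus_diag2.
Qed.

Lemma word_components :
  let W0 := [set p : SL2xSL2 F | commutator_trace p.1 p.2 = 2] in
  let W1 := closure (@antitorus_saturation F) in
  let W2 := [set p : SL2xSL2 F | tr p.1 = 0] in
  irreducible_components [set p : SL2xSL2 F | word_map p.1 p.2 = 1%g] = [set W0; W1; W2] /\
  [/\ W0 <> W1, W0 <> W2 & W1 <> W2].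
Proof.
have Aj := antitorus_antidiag1 F; rewrite word_map_decomposition.
have cubic := closure_sub (@closed_cubic_form F) (subset_trans
  (@antitorus_saturation_sub F) (@antiborel_saturation_cubic_form F)).
apply: irreducible_components3.
- exact: commutator_trace2_irreducible.
- exact/irreducible_closure/antitorus_saturation_irreducible.
- exact: trace0_irreducible.
- exact: closed_commutator_trace.
- exact: closed_closure.
- exact: closed_trace_fst.
- case/(_ (diag 2, 1%g) commutator_trace_diag2_1) => [/cubic|] /eqP.
    exact/negP/cubic_form_diag2_1.
  exact/negP/tr_diag2_neq0.
- have mem := diag2_antidiag_antitorus_saturation Aj.
  case/(_ _ (subset_closure mem)) => [|/eqP]; first exact: commutator_trace_diag2_antitorus.
  exact/negP/tr_diag2_neq0.
- case/(_ (antidiag 1, diag 2) (antitorus_tr Aj)) => [|/cubic/eqP].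
    exact: commutator_trace_antitorus_diag2.
  exact/negP/cubic_form_antitorus_diag2.
Qed.

Lemma eval_word_commutator x y :
  eval_word (word_comm word_x word_y) x y = commutator x y.
Proof. by rewrite eval_word_comm /eval_word !big_seq1. Qed.

Lemma eval_word_word_map x y (c := word_comm word_x word_y) :
  eval_word (word_comm c (word_x ++ c ++ word_inv word_x)) x y = word_map x y.
Proof.
rewrite eval_word_comm [eval_word (word_x ++ _) _ _]eval_word_cat
  [eval_word (c ++ _) _ _]eval_word_cat eval_word_inv eval_word_commutator.
by rewrite /eval_word !big_seq1 /word_map /commutator !mulgA.
Qed.

End MainResult.

Theorem theorem4p15 (R : realType) (dw : SL2 R[i])
  (hdw : (normalizer (@torus R[i]) `\` @torus R[i]) dw) :
  let c := word_comm word_x word_y in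
  let w := word_comm c (word_x ++ c ++ word_inv word_x) in
  let T := @torus R[i] in
  let B := @borel R[i] in
  let T0 : set (SL2xSL2 R[i]) := trace_variety c in
  let T1 : set (SL2xSL2 R[i]) :=
    closure (conj_saturation T (left_translate dw B)) in
  let T2 : set (SL2xSL2 R[i]) := conj_class dw `*` [set: SL2 R[i]] in
  let W0 := T0 in
  let W1 : set (SL2xSL2 R[i]) :=
    closure (conj_saturation T (left_translate dw T)) in
  let W2 := T2 in
  [/\ irreducible_components (trace_variety w) = [set T0; T1; T2],
      [/\ T0 <> T1, T0 <> T2 & T1 <> T2],
      irreducible_components (word_variety w) = [set W0; W1; W2],
      [/\ W0 <> W1, W0 <> W2 & W1 <> W2] &
      W1 `<=` T1 /\ has_krull_dim W1 4].
Proof.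
move=> c w T B T0 T1 T2 W0 W1 W2.
have Adw := normalizer_torus_antitorus hdw.
have T0E : T0 = [set p : SL2xSL2 R[i] | commutator_trace p.1 p.2 = 2].
  by apply/seteqP; split=> p; rewrite /T0 /trace_variety /mkset eval_word_commutator.
have T1E : T1 = closure (@antiborel_saturation R[i]).
  by rewrite /T1 left_translate_borel.
have T2E : T2 = [set p : SL2xSL2 R[i] | tr p.1 = 0].
  by rewrite /T2 conj_class_trace0 //; apply/seteqP; split=> [p []|p].
have W1E : W1 = closure (@antitorus_saturation R[i]).
  by rewrite /W1 left_translate_torus.
have trE : trace_variety w = [set p : SL2xSL2 R[i] | tr (word_map p.1 p.2) = 2].
  by apply/seteqP; split=> p; rewrite /trace_variety /mkset eval_word_word_map.
have wdE : word_variety w = [set p : SL2xSL2 R[i] | word_map p.1 p.2 = 1%g].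
  by apply/seteqP; split=> p; rewrite /word_variety /mkset eval_word_word_map.
rewrite /W0 /W2 T0E T1E T2E W1E trE wdE.
have [trC trN] := trace_components R[i]; have [wdC wdN] := word_components R[i].
split=> //; split; last exact: antitorus_saturation_krull_dim.
exact/closure_subset/antitorus_saturation_sub.
Qed.
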